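(* We have $$\min_{\mathbf{x}\in\mathbb{X}_n}\mathbb{P}\big(\mathsf{H}(\mathcal{T}(\mathbf{x}))\ge e\log(n)-5\log\log n\big)\longrightarrow 1\qquad\text{as } n\to\infty.$$ Also, for every $n$ sufficiently large, $$\min_{\mathbf{x}\in\mathbb{X}_n}\mathbb{E}[\mathsf{H}(\mathcal{T}(\mathbf{x}))]\ge e\log n-5\log\log n.$$
   Context: Uniform attachment with freezing. For a choice sequence $\mathbf{x}=(\mathrm{x}_i)_{1\le i\le m}\in\{-1,+1\}^m$ let $S_0(\mathbf{x})=1$, $S_j(\mathbf{x})=1+\sum_{i=1}^j \mathrm{x}_i$ for $1\le j\le m$, and $\tau(\mathbf{x})=\min\{j\in\{1,\dots,m\}: S_j(\mathbf{x})=0\}$, with the convention $\min\varnothing=\infty$. For $n\ge 1$ define $$\mathbb{X}_n=\bigcup_{m\ge n}\big\{\mathbf{x}=(\mathrm{x}_i)_{1\le i\le m}\in\{-1,+1\}^m:\ \#\{i\in\{1,\dots,m\}:\mathrm{x}_i=+1\}=n \text{ and } \tau(\mathbf{x})\ge m\big\}.$$ For $\mathbf{x}$ of length $m$ with $S_j(\mathbf{x})>0$ for every $1\le j\le m-1$ (in particular for $\mathbf{x}\in\mathbb{X}_n$), random rooted trees $\mathcal{T}_0(\mathbf{x}),\dots,\mathcal{T}_m(\mathbf{x})$, whose vertices are each labelled either active or frozen, are built recursively: $\mathcal{T}_0(\mathbf{x})$ is a single active root vertex; for $1\le j\le m$, let $V_j$ be a uniformly random active vertex of $\mathcal{T}_{j-1}(\mathbf{x})$,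 chosen independently of all previous choices; if $\mathrm{x}_j=-1$ (freezing step), $\mathcal{T}_j(\mathbf{x})$ is obtained from $\mathcal{T}_{j-1}(\mathbf{x})$ by changing the label of $V_j$ from active to frozen; if $\mathrm{x}_j=+1$ (attachment step), $\mathcal{T}_j(\mathbf{x})$ is obtained from $\mathcal{T}_{j-1}(\mathbf{x})$ by adding a new active vertex joined by an edge to $V_j$. Thus $S_j(\mathbf{x})$ is the number of active vertices of $\mathcal{T}_j(\mathbf{x})$. Set $\mathcal{T}(\mathbf{x})=\mathcal{T}_m(\mathbf{x})$. The height $\mathsf{H}(T)$ of a rooted tree $T$ is the maximal graph distance of a vertex of $T$ to the root. Here $\log$ is the natural logarithm and $e$ is its base. *)

(* Defs.v *)
From HB Require Import structures.
From mathcomp Require Import all_boot all_order all_algebra.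
From mathcomp Require Import zify ring lra.
From mathcomp Require Import all_classical all_reals all_analysis.

Set Implicit Arguments.
Unset Strict Implicit.
Unset Printing Implicit Defensive.

Import Order.TTheory GRing.Theory Num.Theory.
Import numFieldNormedType.Exports.

Local Open Scope classical_set_scope.
Local Open Scope ring_scope.

(* A choice sequence is a [seq bool]: [true] stands for +1 (attachment) and
   [false] for -1 (freezing). *)

Definition incr (b : bool) : int := if b then 1 else -1.

Definition S_ (x : seq bool) (j : nat) : int := 1 + \sum_(b <- take j x) incr b.

(* [None] stands for [tau x = oo]. *)
Definition tau (x : seq bool) : option nat :=
  ohead [seq j <- iota 1 (size x) | S_ x j == 0].

Definition le_tau (m : nat) (t : option nat) : bool :=
  if t is Some j then (m <= j)%N else true.

Definition XX (n : nat) : set (seq bool) :=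
  [set x | [&& (n <= size x)%N, count_mem true x == n & le_tau (size x) (tau x)]].

(* Length of a shortest path from [u] to [v]; since a shortest path has fewer
   than [#|V|] edges, the value is [#|V|] exactly when there is no path. *)
Definition gdist (V : finType) (e : rel V) (u v : V) : nat :=
  find (fun k => [exists p : k.-tuple V, path e u p && (last u p == v)])
       (iota 0 #|V|).

(* The vertices of [T] are [0, ..., maxv T], numbered in order of appearance,
   and the root is [0]; values of [adj T] and [active T] at larger integers
   are irrelevant. *)

Record tree := Tree {
  maxv : nat;
  adj : rel nat;
  active : pred nat (* [false] means frozen *)
}.

Definition actives (T : tree) : seq nat :=
  [seq v <- iota 0 (maxv T).+1 | active T v].

Definition tree0 : tree := Tree 0 (fun _ _ => false) (fun v => v == 0%N).

Definition freeze (T : tree) (v : nat) : tree :=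
  Tree (maxv T) (adj T) (fun u => (u != v) && active T u).

Definition attach (T : tree) (v : nat) : tree :=
  let w := (maxv T).+1 in
  Tree w
    (fun a b => [|| adj T a b, (a == v) && (b == w) | (a == w) && (b == v)])
    (fun u => (u == w) || active T u).

Definition height (T : tree) : nat :=
  \max_(v < (maxv T).+1) gdist (fun a b : 'I_(maxv T).+1 => adj T a b) ord0 v.

(* A finitely supported distribution is a list of weighted outcomes, in which
   an outcome may be repeated. *)

Section Distributions.
Variable R : realType.

Definition distr (A : Type) := seq (R * A).

Definition dret A (a : A) : distr A := [:: (1, a)].

Definition dbind A B (mu : distr A) (k : A -> distr B) : distr B :=
  flatten [seq [seq (pa.1 * qb.1, qb.2) | qb <- k pa.2] | pa <- mu].

(* Only used on duplicate-free nonempty lists; see [law_mass1]. *)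
Definition unif A (s : seq A) : distr A := [seq ((size s)%:R^-1, a) | a <- s].

Definition Pr A (mu : distr A) (E : pred A) : R := \sum_(pa <- mu | E pa.2) pa.1.

Definition Ex A (mu : distr A) (f : A -> R) : R := \sum_(pa <- mu) pa.1 * f pa.2.

(* One transition: given the current tree, the vertex [v] is uniform among its
   active vertices, independently of how that tree was reached. *)
Definition step (b : bool) (T : tree) : distr tree :=
  dbind (unif (actives T))
        (fun v => dret (if b then attach T v else freeze T v)).

(* The law of the final tree T(x). On the sequences of [XX n] there is always
   an active vertex to choose from, so it has total mass 1. *)
Definition law (x : seq bool) : distr tree :=
  foldl (fun mu b => dbind mu (step b)) (dret tree0) x.

End Distributions.

Lemma S_rcons x b j : (j <= size x)%N -> S_ (rcons x b) j = S_ x j.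
Proof. by move=> jx; rewrite /S_ -cats1 takel_cat. Qed.

Lemma S_last x b : S_ (rcons x b) (size x).+1 = S_ x (size x) + incr b.
Proof.
rewrite /S_ take_oversize ?size_rcons// take_size -cats1 big_cat /=.
by rewrite big_seq1 addrA.
Qed.

Lemma S_S x j : (j < size x)%N -> S_ x j.+1 = S_ x j + incr (nth false x j).
Proof.
move=> jx; rewrite /S_ (take_nth false jx) -cats1 big_cat /= big_seq1.
by rewrite addrA.
Qed.

Lemma XX_gt0 n x : XX n x -> forall j, (j < size x)%N -> 0 < S_ x j.
Proof.
move=> /and3P[_ _ tx]; elim=> [|j IH] jx; first by rewrite /S_ take0 big_nil.
have /IH Sj : (j < size x)%N by lia.
have SN0 : S_ x j.+1 != 0.
  apply/negP => S0; move: tx; rewrite /tau /le_tau.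
  have jin : j.+1 \in [seq k <- iota 1 (size x) | S_ x k == 0].
    by rewrite mem_filter S0 mem_iota; lia.
  have : sorted leq [seq k <- iota 1 (size x) | S_ x k == 0].
    by apply: sorted_filter; [exact: leq_trans | exact: iota_sorted].
  case: [seq _ <- _ | _] jin => [//|k s] /=; rewrite in_cons.
  move=> /orP[/eqP<- _|js /(order_path_min leq_trans)/allP/(_ _ js)]; lia.
move: SN0; rewrite S_S; last by lia.
by rewrite /incr; case: (nth _ _ _); lia.
Qed.

Lemma S_count x : S_ x (size x) = 1 + (count_mem true x)%:Z *+ 2 - (size x)%:Z.
Proof.
elim/last_ind: x => [|x b IH]; first by rewrite /S_ /= big_nil.
rewrite size_rcons S_last IH -cats1 count_cat /= /incr.
by case: b => /=; lia.
Qed.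

Lemma XX_size n x : XX n x -> (size x <= n.*2.+1)%N.
Proof.
move=> Xx; have S0 := XX_gt0 Xx; move: Xx => /and3P[_ /eqP cx _].
have : 0 <= S_ x (size x).
  case: (posnP (size x)) => [/size0nil ->|x0]; first by rewrite /S_ big_nil.
  have := S0 (size x).-1; rewrite prednK// => /(_ (leqnn _)).
  have := @S_S x (size x).-1; rewrite prednK// => ->//.
  by rewrite /incr; case: (nth _ _ _); lia.
by rewrite S_count cx; lia.
Qed.

Lemma finite_XX n : finite_set (XX n).
Proof.
apply: (@sub_finite_set _ _ [set` flatten
  [seq [seq val t | t <- enum {: i.-tuple bool}] | i <- iota 0 n.*2.+2]]);
  last exact: finite_seq.
move=> x /XX_size sx; rewrite /mkset; apply/flattenP.
exists [seq val t | t <- enum {: (size x).-tuple bool}].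
  by apply/mapP; exists (size x); rewrite ?mem_iota//; lia.
by apply/mapP; exists (in_tuple x); rewrite // mem_enum.
Qed.

Lemma XX_nonempty n : XX n (nseq n true).
Proof.
rewrite /XX /= size_nseq leqnn count_nseq mul1n eqxx /=.
rewrite /tau; set s := [seq _ <- _ | _]; suff -> : s = [::] by [].
apply/eqP; rewrite /s -size_eq0 size_filter -leqn0 leqNgt -has_count.
apply/hasPn => j; rewrite mem_iota size_nseq => jn.
have -> : S_ (nseq n true) j = 1 + j%:Z; last by lia.
rewrite /S_ take_nseq; last by lia.
by rewrite big_nseq /incr; elim: j {jn} => //= j; lia.
Qed.

(* Infima over [XX n] are minima. *)
Lemma inf_XX_min (R : realType) (n : nat) (f : seq bool -> R) :
  let m := inf [set f x | x in XX n] in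
  (exists2 x, XX n x & f x = m) /\ (forall x, XX n x -> m <= f x).
Proof.
have /finite_seqP[s sE] := finite_XX n.
have xin y : XX n y <-> y \in s by rewrite sE.
have x0 : exists i : 'I_(size s), true.
  have /xin := XX_nonempty n; rewrite -index_mem => i0.
  by exists (Ordinal i0).
move: x0 => [i0 _].
pose i := [arg min_(i < i0) f (nth [::] s i)]%O.
have imin x : XX n x -> f (nth [::] s i) <= f x.
  move=> /xin xs; rewrite /i; case: arg_minP => //= k _ kmin.
  have xi : (index x s < size s)%N by rewrite index_mem.
  by have := kmin (Ordinal xi) isT; rewrite /= nth_index.
have Xi : XX n (nth [::] s i) by apply/xin; rewrite mem_nth.
suff -> : inf [set f x | x in XX n] = f (nth [::] s i).
  by split=> //; exists (nth [::] s i).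
apply/eqP; rewrite eq_le; apply/andP; split.
  apply: ge_inf; last by exists (nth [::] s i).
  by exists (f (nth [::] s i)) => _ [x Xx <-]; exact: imin.
apply: lb_le_inf; first by exists (f (nth [::] s i)), (nth [::] s i).
by move=> _ [x Xx <-]; exact: imin.
Qed.

Lemma size_actives_attach T v : size (actives (attach T v)) = (size (actives T)).+1.
Proof.
rewrite /actives [maxv _]/= -[X in iota 0 X]addn1 iotaD filter_cat size_cat.
rewrite add0n [X in (_ + size X)%N]/= eqxx addn1; congr _.+1; congr (size _).
apply: eq_in_filter => u; rewrite mem_iota => uT.
by rewrite /=; have -> : (u == (maxv T).+1) = false by lia.
Qed.

Lemma size_actives_freeze T v :
  v \in actives T -> size (actives (freeze T v)) = (size (actives T)).-1.
Proof.
move=> vT; rewrite -(size_rem vT) rem_filter ?filter_uniq ?iota_uniq//.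
by rewrite /actives -filter_predI; congr size; exact: eq_filter.
Qed.

Lemma Ex_dbind (R : realType) A B (mu : distr R A) (k : A -> distr R B) f :
  Ex (dbind mu k) f = Ex mu (fun a => Ex (k a) f).
Proof.
rewrite /Ex /dbind big_flatten big_map /=; apply: eq_bigr => pa _.
by rewrite big_map mulr_sumr; apply: eq_bigr => qb _; rewrite /= mulrA.
Qed.

Lemma eq_Ex_all (R : realType) A (P : pred A) (mu : distr R A) (f g : A -> R) :
  all (fun pa => P pa.2) mu -> (forall a, P a -> f a = g a) -> Ex mu f = Ex mu g.
Proof.
move=> + fg; rewrite /Ex; elim: mu => [|pa mu IH] /=; first by rewrite !big_nil.
by case/andP=> Pa /IH; rewrite !big_cons fg// => ->.
Qed.

Lemma law_rcons (R : realType) x b :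
  law R (rcons x b) = dbind (law R x) (step R b).
Proof. by rewrite /law foldl_rcons. Qed.

Lemma law_size_actives (R : realType) x :
  all (fun pT => (size (actives pT.2))%:Z == S_ x (size x)) (law R x).
Proof.
elim/last_ind: x => [|x b IH]; first by rewrite /law /= /S_ big_nil.
have all_flatten A (P : pred A) ss : all P (flatten ss) = all (all P) ss.
  by elim: ss => //= s ss IHs; rewrite all_cat IHs.
rewrite law_rcons size_rcons S_last /dbind all_flatten all_map.
apply: sub_all IH => -[p T] /= /eqP <-; rewrite all_map.
rewrite /step /dbind /unif -map_comp flatten_map1 !all_map /=.
apply/allP => v vT /=; case: b => /=.
  by rewrite size_actives_attach /incr; lia.
rewrite size_actives_freeze// /incr.
by have : (0 < size (actives T))%N by [case: (actives T) vT]; lia.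
Qed.

Lemma law_mass1 (R : realType) x :
  (forall j, (j < size x)%N -> 0 < S_ x j) -> Ex (law R x) (fun=> 1) = 1.
Proof.
elim/last_ind: x => [|x b IH] Sx.
  by rewrite /Ex /law /= big_seq1 mulr1.
have {}IH : Ex (law R x) (fun=> 1) = 1.
  apply: IH => j jx; rewrite -(@S_rcons x b); last exact: ltnW.
  by apply: Sx; rewrite size_rcons; lia.
have Sx0 : 0 < S_ x (size x).
  by rewrite -(@S_rcons x b)//; apply: Sx; rewrite size_rcons.
rewrite law_rcons Ex_dbind -[RHS]IH.
apply: (@eq_Ex_all _ _ (fun T => (size (actives T))%:Z == S_ x (size x))).
  exact: law_size_actives.
move=> T /eqP ST.
have T0 : (0 < size (actives T))%N by rewrite -ltz_nat ST.
rewrite Ex_dbind /Ex /unif big_map /=.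
under eq_bigr do rewrite big_seq1 /= !mulr1.
rewrite big_const_seq count_predT iter_addr_0 -[_ *+ _]mulr_natr mulVf//.
by rewrite pnatr_eq0 -lt0n.
Qed.

(* Main.v *)
Require Import Defs.
From mathcomp Require Import all_boot all_order all_algebra.
From mathcomp Require Import zify ring lra.
From mathcomp Require Import all_classical all_reals all_analysis.

(** Follow a uniform active vertex backwards in time. At an attachment leaving [S] active
    vertices it is the new one with probability [1 / S], in which case it is replaced by
    its parent; at a freezing step nothing happens. Its depth is thus a sum of independent
    Bernoulli variables of parameters [1 / S] ([mean_average]), with mean the clock
    [\sum 1 / S]. Two distinct uniform active vertices have almost independent lineages,
    until they merge at an attachment, with a probability of order [S ^- 2]
    ([mean_pairavg]). So everything reduces to the study of one lineage.

    Stop at a time with [L] active vertices. For each level [l <= L], call record the last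
    attachment after which there are [l] active vertices ([recordb]). Along the records
    alone, lineages are those of a random recursive tree with [L] vertices, where [L] times
    the probability of a sum of independent Bernoulli variables of parameters [1 / l] being
    at least [e * ln L] is 1 up to powers of [ln L]: this is where [e] comes from. The
    other edges are independent of the record ones and their number is concentrated around
    their share of the clock ([few_edges]).

    The second moment of the number of deep vertices is dominated by rare events on which
    some lineages have too many record edges too soon. So only those lineages are kept
    whose number of record edges, counted from a level [l0] on, stays at each level [l]
    below [e * ln (l / l0)] up to a constant. A lineage on this line survives with
    probability of order at most [l / L], by a Chernoff bound ([survive_le]); hence the
    pairs merging at [S >= l] active vertices add to the second moment, relatively to the
    square of the first one, a term of order [1 / (L * p * S)], where [p] is the
    probability that a lineage survives from level [l0] on ([merges_deco]). The lower
    bound [p >= l0 / L * (ln n) ^ (- 3 / 2)] is a ballot theorem; it is obtained by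
    exhibiting an explicit subsolution of the backward equation of the lineage, built on
    Abel polynomials ([ballot_step], [subsol_le_survive]). If the clock is [O (ln n)], the
    pairs which merge after level [l0] then contribute at most [(ln n) ^ (5 / 2) / l0], up
    to a small power of [ln n], so that [l0 = (ln n) ^ A] with [A > 26 / 10] makes the
    second moment method work ([mean_deep_second]). Pairs which merge before level [l0]
    are harmless, since nothing is required there. This costs [e * A * ln (ln n)] in the
    height, of which nearly [A * ln (ln n)] is regained by counting the typical number of
    edges before [l0].

    It remains to choose the time ([exists_good_prefix]). Each attachment is [S] times its
    contribution to the clock, so that [n / 2] attachments force [S] to be at some time at
    least of order [n * expR (- T2 / 12)], where [T2] is the clock since the middle of the
    sequence. The loss [e * T2 / 12] is less than what the non-record edges bring, because
    the clock exceeds by [T2] what the records can use. If the clock exceeds [6 * ln n],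
    a uniform active vertex is already deep enough ([mean_deep_long_clock]).

    With [A = 27 / 10] the total loss is less than [(492 / 100) * ln (ln n)]. For the
    expectation, a second application with [A = 24] gives a height at least
    [e * ln n - 55 * ln (ln n)] outside an event of probability [o (1 / ln n)]
    ([expectation_arith]). *)

Import Order.TTheory GRing.Theory Num.Theory.
Import numFieldNormedType.Exports.
Local Open Scope classical_set_scope.
Local Open Scope ring_scope.

Set Implicit Arguments.
Unset Strict Implicit.
Unset Printing Implicit Defensive.

(** * Growth of a tree with labelled vertices *)

Section Labelled.
Context {R : realType} {A : Type}.

Definition labelled := (tree * (nat -> A))%type.

(** A step is a choice together with the way in which the label of a new vertex is
    computed from the label of its parent. Labels record what is needed of the ancestral
    line of a vertex; they do not influence the growth. *)
Definition next (s : bool * (A -> A)) (st : labelled) (v : nat) : labelled :=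
  if s.1 then
    (attach st.1 v,
     fun w => if w == (maxv st.1).+1 then s.2 (st.2 v) else st.2 w)
  else (freeze st.1 v, st.2).

Definition meanstep (s : bool * (A -> A)) (st : labelled) (phi : labelled -> R) : R :=
  (size (actives st.1))%:R^-1 * \sum_(v <- actives st.1) phi (next s st v).

(** Expectations are computed from the first step on, which allows inductions on the
    remaining steps. *)
Fixpoint mean (z : seq (bool * (A -> A))) (st : labelled) (phi : labelled -> R) : R :=
  if z is s :: z' then meanstep s st (fun st' => mean z' st' phi) else phi st.

Lemma mean_cat z1 z2 st phi :
  mean (z1 ++ z2) st phi = mean z1 st (fun st' => mean z2 st' phi).
Proof.
elim: z1 st => //= s z1 IH st; rewrite /meanstep; congr (_ * _).
by apply: eq_bigr => v _; exact: IH.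
Qed.

Lemma Ex_step b (u : A -> A) (T : tree) (lab : nat -> A) (f : tree -> R) :
  Ex (step R b T) f = meanstep (b, u) (T, lab) (fun st => f st.1).
Proof.
rewrite /step Ex_dbind /Ex /unif big_map /meanstep mulr_sumr.
apply: eq_bigr => v _ /=; rewrite big_seq1 /= mul1r /next /=.
by case: b.
Qed.

Lemma Ex_law_mean (z : seq (bool * (A -> A))) (lab : nat -> A) (f : tree -> R) :
  Ex (law R [seq s.1 | s <- z]) f = mean z (tree0, lab) (fun st => f st.1).
Proof.
have gen (mu : distr R tree) (g : tree -> nat -> A) :
    Ex (foldl (fun mu b => dbind mu (step R b)) mu [seq s.1 | s <- z]) f
    = Ex mu (fun T => mean z (T, g T) (fun st => f st.1)).
  elim: z mu g => [|[b u] z IH] mu g //=.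
  pose K T l := mean z (T, l) (fun st => f st.1).
  have Kind T l l' : K T l = K T l'.
    rewrite /K; elim: z {IH K} T l l' => [//|[b' u'] z IHz] T l l' /=.
    rewrite /meanstep; congr (_ * _); apply: eq_bigr => v _.
    by rewrite /next; case: b' => /=; exact: IHz.
  rewrite (IH _ (fun=> lab)) Ex_dbind; congr Ex; apply/funext => T.
  rewrite (Ex_step b u T (g T)) /meanstep; congr (_ * _).
  by apply: eq_bigr => v _; rewrite /next; case: b => /=; exact: Kind.
rewrite /law (gen _ (fun=> lab)) /Ex /dret big_seq1 /= mul1r.
by [].
Qed.

Lemma meanstep_le s st phi psi :
  (forall v, v \in actives st.1 -> phi (next s st v) <= psi (next s st v)) ->
  meanstep s st phi <= meanstep s st psi.
Proof.
move=> H; rewrite /meanstep; apply: ler_wpM2l; first by rewrite invr_ge0.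
by rewrite big_seq [X in _ <= X]big_seq; exact: ler_sum.
Qed.

Lemma mean_le_inv (I : labelled -> Prop) z st phi psi :
  (forall s st v, List.In s z -> I st -> v \in actives st.1 -> I (next s st v)) ->
  I st -> (forall st, I st -> phi st <= psi st) ->
  mean z st phi <= mean z st psi.
Proof.
elim: z st => [|s z IH] st Is Ist H /=; first exact: H.
apply: meanstep_le => v vT; apply: IH => //.
  by move=> s' st' v' s'z; apply: Is; right.
by apply: Is => //; left.
Qed.

Lemma mean_le z st phi psi :
  (forall st, phi st <= psi st) -> mean z st phi <= mean z st psi.
Proof. by move=> H; apply: (@mean_le_inv (fun=> True)). Qed.

Lemma meanstepD s st phi psi :
  meanstep s st (fun x => phi x + psi x) = meanstep s st phi + meanstep s st psi.
Proof. by rewrite /meanstep big_split mulrDr. Qed.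

Lemma meanstepZ s st c phi :
  meanstep s st (fun x => c * phi x) = c * meanstep s st phi.
Proof. by rewrite /meanstep -mulr_sumr mulrCA. Qed.

Lemma meanD z st phi psi :
  mean z st (fun x => phi x + psi x) = mean z st phi + mean z st psi.
Proof.
elim: z st => //= s z IH st; rewrite -meanstepD /meanstep.
by congr (_ * _); apply: eq_bigr => v _; rewrite IH.
Qed.

Lemma meanZ z st c phi : mean z st (fun x => c * phi x) = c * mean z st phi.
Proof.
elim: z st => //= s z IH st; rewrite -meanstepZ /meanstep.
by congr (_ * _); apply: eq_bigr => v _; rewrite IH.
Qed.

Definition nxt (S : nat) (b : bool) : nat := if b then S.+1 else S.-1.

Fixpoint pos (S : nat) (x : seq bool) : bool :=
  (0 < S)%N && (if x is b :: x' then pos (nxt S b) x' else true).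

Lemma pos_gt0 S x : pos S x -> (0 < S)%N.
Proof. by case: x => [|b x] /= /andP[]. Qed.

Lemma size_actives_next s st v : v \in actives st.1 ->
  size (actives (next s st v).1) = nxt (size (actives st.1)) s.1.
Proof.
move=> vT; rewrite /next; case: s => -[] u /=; first exact: size_actives_attach.
exact: size_actives_freeze.
Qed.

Lemma meanstep_cst s st c :
  (0 < size (actives st.1))%N -> meanstep s st (fun=> c) = c.
Proof.
move=> S0; rewrite /meanstep big_const_seq count_predT iter_addr_0.
by rewrite -(mulr_natr c) mulrCA mulVf ?mulr1// pnatr_eq0 -lt0n.
Qed.

Definition asum (st : labelled) (g : A -> R) : R :=
  \sum_(v <- actives st.1) g (st.2 v).

Lemma actives_attach T v :
  actives (attach T v) = rcons (actives T) (maxv T).+1.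
Proof.
rewrite /actives [maxv _]/= -[X in iota 0 X]addn1 iotaD filter_cat add0n -cats1.
congr (_ ++ _); last by rewrite /= eqxx.
apply: eq_in_filter => u; rewrite mem_iota => uT.
by rewrite /=; have -> : (u == (maxv T).+1) = false by lia.
Qed.

Lemma asum_attach u st v g : v \in actives st.1 ->
  asum (next (true, u) st v) g = asum st g + g (u (st.2 v)).
Proof.
move=> vT; rewrite /asum /next [(_, _).1]/= [(_, _).2]/= actives_attach.
rewrite -cats1 big_cat big_seq1 /= eqxx; congr (_ + _).
rewrite big_seq [RHS]big_seq; apply: eq_bigr => w.
rewrite mem_filter mem_iota => /andP[_ wT].
by have -> : (w == (maxv st.1).+1) = false by lia.
Qed.

Lemma asum_freeze u st v g : v \in actives st.1 ->
  asum (next (false, u) st v) g = asum st g - g (st.2 v).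
Proof.
move=> vT; rewrite /asum /next /= [in RHS](big_rem v vT) /= addrAC subrr add0r.
rewrite rem_filter ?filter_uniq ?iota_uniq// /actives -filter_predI.
by apply: congr_big => //; exact: eq_filter.
Qed.

Lemma asumD st f g : asum st (fun a => f a + g a) = asum st f + asum st g.
Proof. by rewrite /asum big_split. Qed.

Lemma asumZ st c f : asum st (fun a => c * f a) = c * asum st f.
Proof. by rewrite /asum mulr_sumr. Qed.

Lemma asum_le st f g : (forall v, v \in actives st.1 -> f (st.2 v) <= g (st.2 v)) ->
  asum st f <= asum st g.
Proof. by move=> H; rewrite /asum big_seq [X in _ <= X]big_seq; exact: ler_sum. Qed.

Lemma asum_ge0 st f : (forall a, 0 <= f a) -> 0 <= asum st f.
Proof. by move=> H; exact: sumr_ge0. Qed.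

Lemma asum_cst st c : asum st (fun=> c) = c * (size (actives st.1))%:R.
Proof.
by rewrite /asum big_const_seq count_predT iter_addr_0 mulr_natr.
Qed.

(** [asum f * asum g] also counts the pairs of distinct vertices. *)
Lemma asum_mul_ge st f g : (forall a, 0 <= f a) -> (forall a, 0 <= g a) ->
  asum st (fun a => f a * g a) <= asum st f * asum st g.
Proof.
move=> f0 g0; rewrite /asum; elim: (actives st.1) => [|v s IH].
  by rewrite !big_nil mulr0.
rewrite !big_cons.
have fs : 0 <= \sum_(j <- s) f (st.2 j) by apply: sumr_ge0.
have gs : 0 <= \sum_(j <- s) g (st.2 j) by apply: sumr_ge0.
have := mulr_ge0 (f0 (st.2 v)) gs; have := mulr_ge0 fs (g0 (st.2 v)).
by move: IH; lra.
Qed.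

End Labelled.

(** * First and second moments over the active vertices *)

Section Moments.
Context {R : realType} {A : Type}.
Implicit Types (z : seq (bool * (A -> A))) (st : @labelled A) (g f : A -> R).

Definition endS (S : nat) (x : seq bool) : nat := foldl nxt S x.

Notation walk z := [seq s.1 | s <- z].

(** The label of a uniform active vertex, seen backwards in time, changes at an
    attachment leaving [S.+1] active vertices with probability [1 / S.+1], and
    never changes at a freezing step: [lineage] is the backward operator of this
    inhomogeneous Markov chain. *)
Fixpoint lineage (S : nat) z g : A -> R :=
  match z with
  | [::] => g
  | (true, u) :: z' => fun a =>
      (1 - S.+1%:R^-1) * lineage S.+1 z' g a + S.+1%:R^-1 * lineage S.+1 z' g (u a)
  | (false, _) :: z' => lineage S.-1 z' g
  end.

Lemma invS_ge0 (n : nat) : 0 <= n.+1%:R^-1 :> R.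
Proof. by rewrite invr_ge0. Qed.

Lemma invS_le1 (n : nat) : n.+1%:R^-1 <= 1 :> R.
Proof. by rewrite invf_le1 ?ler1n// ltr0n. Qed.

Lemma lineage_ge0 S z g : (forall a, 0 <= g a) -> forall a, 0 <= lineage S z g a.
Proof.
move=> g0; elim: z S => [|[[] u] z IH] S a //=.
apply: addr_ge0; apply: mulr_ge0; rewrite ?IH ?invS_ge0//.
by rewrite subr_ge0 invS_le1.
Qed.

(** Many-to-one formula: at an attachment the average of [g] over [S] active vertices
    becomes in mean that of [lineage S [:: (true, u)] g], and at a freezing step it is
    unchanged, since the frozen vertex is uniform. *)
Theorem mean_average z st g : pos (size (actives st.1)) (walk z) ->
  mean z st (fun st' => asum st' g / (size (actives st'.1))%:R)
  = asum st (lineage (size (actives st.1)) z g) / (size (actives st.1))%:R.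
Proof.
elim: z st => [|[b u] z IH] st //= /andP[S0 pS].
set S := size _ in S0 pS *.
have nS v : v \in actives st.1 ->
    size (actives (next (b, u) st v).1) = nxt S b.
  by move=> /size_actives_next ->.
have Sn0 : S%:R != 0 :> R by rewrite pnatr_eq0 -lt0n.
have SS0 : S.+1%:R != 0 :> R by rewrite pnatr_eq0.
rewrite /meanstep big_seq (eq_bigr (fun v =>
  asum (next (b, u) st v) (lineage (nxt S b) z g) / (nxt S b)%:R)); last first.
  by move=> v vT; rewrite IH nS.
set G := lineage (nxt S b) z g.
case: b => /= in pS nS G *.
  rewrite (eq_bigr (fun v => (asum st G + G (u (st.2 v))) / S.+1%:R)); last first.
    by move=> v vT; rewrite asum_attach.
  rewrite -mulr_suml -big_seq big_split /=.
  rewrite big_const_seq count_predT iter_addr_0 -/S.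
  rewrite -/(asum st (fun a => G (u a))) asumD !asumZ -/G.
  rewrite -(mulr_natr (asum st G)).
  rewrite -[in X in _ = X]natr1 -[in X in X = _]natr1.
  by field; rewrite natr1 Sn0.
have [S1|S1] := ltnP 1 S; last by have := pos_gt0 pS; lia.
have Sp0 : S.-1%:R != 0 :> R by rewrite pnatr_eq0; lia.
rewrite (eq_bigr (fun v => (asum st G - G (st.2 v)) / S.-1%:R)); last first.
  by move=> v vT; rewrite asum_freeze.
rewrite -mulr_suml -big_seq sumrB /=.
rewrite big_const_seq count_predT iter_addr_0 -/S.
rewrite -/(asum st G) -(mulr_natr (asum st G)).
have -> : S%:R = S.-1%:R + 1 :> R by rewrite natr1 prednK.
by field; rewrite natr1 prednK ?Sn0.
Qed.

(** The sum of [f * g] over the ordered pairs of distinct active vertices. *)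
Definition pairsum st f g : R :=
  asum st f * asum st g - asum st (fun a => f a * g a).

(** Unlike the square of the average, the average over pairs of distinct vertices does
    not increase in mean at a freezing step. It is [0] when there is no pair. *)
Definition pairavg st f : R :=
  pairsum st f f / ((size (actives st.1))%:R * (size (actives st.1)).-1%:R).

(** The contribution of the pairs of lineages which merge at each of the
    attachments of [z]. *)
Fixpoint merges (S : nat) z g : A -> R :=
  match z with
  | [::] => fun=> 0
  | (true, u) :: z' => fun a =>
      (1 - S.+1%:R^-1) * merges S.+1 z' g a + S.+1%:R^-1 * merges S.+1 z' g (u a)
      + 2 / (S.+1%:R * S%:R) * (lineage S.+1 z' g a * lineage S.+1 z' g (u a))
  | (false, _) :: z' => merges S.-1 z' g
  end.

Lemma pairsum_ge0 st f g : (forall a, 0 <= f a) -> (forall a, 0 <= g a) ->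
  0 <= pairsum st f g.
Proof. by move=> f0 g0; rewrite subr_ge0 asum_mul_ge. Qed.

Lemma eq_asum st f g : f =1 g -> asum st f = asum st g.
Proof. by move=> fg; rewrite /asum; apply: eq_bigr => v _. Qed.

Lemma pairsum_comb st (c d : R) f g :
  pairsum st (fun a => c * f a + d * g a) (fun a => c * f a + d * g a)
  = c ^+ 2 * pairsum st f f + 2 * c * d * pairsum st f g + d ^+ 2 * pairsum st g g.
Proof.
rewrite /pairsum asumD !asumZ.
rewrite (@eq_asum st (fun a => (c * f a + d * g a) * (c * f a + d * g a))
  (fun a => c ^+ 2 * (f a * f a) +
   (2 * c * d * (f a * g a) + d ^+ 2 * (g a * g a)))); last by move=> a /=; ring.
by rewrite !asumD !asumZ; ring.
Qed.

Lemma pairsum_attach u st v g : v \in actives st.1 ->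
  pairsum (next (true, u) st v) g g
  = pairsum st g g + 2 * asum st g * g (u (st.2 v)).
Proof. by move=> vT; rewrite /pairsum !asum_attach//=; ring. Qed.

Lemma pairsum_freeze u st v g : v \in actives st.1 ->
  pairsum (next (false, u) st v) g g
  = pairsum st g g - 2 * asum st g * g (st.2 v) + 2 * (g (st.2 v) * g (st.2 v)).
Proof. by move=> vT; rewrite /pairsum !asum_freeze//=; ring. Qed.

Lemma pairsum_single st f g : size (actives st.1) = 1%N -> pairsum st f g = 0.
Proof.
rewrite /pairsum /asum; case: (actives st.1) => [|v []]//= _.
by rewrite !big_seq1 subrr.
Qed.

(** One attachment, from [S] to [S.+1] active vertices: the new vertex replaces in a
    pair either its parent or the other vertex of the pair. *)
Lemma pairavg_attach u st g (S := size (actives st.1)) : (0 < S)%N ->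
  (forall a, 0 <= g a) ->
  meanstep (true, u) st (fun st' => pairavg st' g)
  <= pairavg st (fun a => (1 - S.+1%:R^-1) * g a + S.+1%:R^-1 * g (u a))
     + asum st (fun a => 2 / (S.+1%:R * S%:R) * (g a * g (u a))) / S%:R.
Proof.
move=> S0 g0.
have Sn0 : S%:R != 0 :> R by rewrite pnatr_eq0 -lt0n.
have SS0 : S.+1%:R != 0 :> R by rewrite pnatr_eq0.
rewrite /meanstep big_seq (eq_bigr (fun v =>
  (pairsum st g g + 2 * asum st g * g (u (st.2 v))) / (S.+1%:R * S%:R))); last first.
  by move=> v vT; rewrite /pairavg pairsum_attach// size_actives_next.
rewrite -mulr_suml -big_seq big_split /= -mulr_sumr.
rewrite big_const_seq count_predT iter_addr_0 -/S -(mulr_natr (pairsum _ _ _)).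
rewrite -/(asum st (fun a => g (u a))).
set gu := fun a => g (u a).
have -> : 2 * asum st g * asum st gu
    = 2 * (pairsum st g gu + asum st (fun a => g a * gu a)).
  by rewrite /pairsum subrK mulrA.
rewrite asumZ /pairavg pairsum_comb -/S.
have D0 := pairsum_ge0 st g0 g0.
have gu0 a : 0 <= gu a by exact: g0.
have E0 := pairsum_ge0 st g0 gu0; have F0 := pairsum_ge0 st gu0 gu0.
set D := pairsum st g g in D0 *; set E := pairsum st g gu in E0 *.
set F := pairsum st gu gu in F0 *; set M := asum _ _.
rewrite -/gu.
have [S1|S1] := ltnP 1 S; last first.
  have {}S1 : S = 1%N by lia.
  rewrite /D /E /F !pairsum_single// S1.
  by rewrite !mulr0 !addr0 mul0r !add0r; lra.
have P0 : 0 < S.-1%:R :> R by rewrite ltr0n; lia.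
have SE : S%:R = S.-1%:R + 1 :> R by rewrite natr1 prednK.
have SSE : S.+1%:R = S.-1%:R + 1 + 1 :> R by rewrite -SE natr1.
rewrite SSE SE; set p := S.-1%:R in P0 *.
have -> : (p + 1)^-1 * ((D * (p + 1) + 2 * (E + M)) / ((p + 1 + 1) * (p + 1)))
  = D / ((p + 1) * (p + 1 + 1)) + 2 * E / ((p + 1) ^+ 2 * (p + 1 + 1))
    + 2 / ((p + 1 + 1) * (p + 1)) * M / (p + 1).
  by field; do ?[apply/andP; split]; apply/eqP; lra.
apply: lerD => //.
have -> : ((1 - (p + 1 + 1)^-1) ^+ 2 * D + 2 * (1 - (p + 1 + 1)^-1) * (p + 1 + 1)^-1 * E
    + (p + 1 + 1)^-1 ^+ 2 * F) / ((p + 1) * p)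
  = D / ((p + 1) * (p + 1 + 1)) + 2 * E / ((p + 1) ^+ 2 * (p + 1 + 1))
    + (D / ((p + 1) * (p + 1 + 1) ^+ 2 * p)
       + 2 * E / ((p + 1 + 1) ^+ 2 * (p + 1) ^+ 2 * p)
       + F / ((p + 1 + 1) ^+ 2 * (p + 1) * p)).
  by field; do ?[apply/andP; split]; apply/eqP; lra.
rewrite lerDl; apply: addr_ge0; [apply: addr_ge0|]; apply: divr_ge0 => //;
  rewrite ?mulr_ge0 ?exprn_ge0//; lra.
Qed.

Lemma pairavg_freeze u st g (S := size (actives st.1)) : (1 < S)%N ->
  (forall a, 0 <= g a) ->
  meanstep (false, u) st (fun st' => pairavg st' g) <= pairavg st g.
Proof.
move=> S1 g0.
have P0 : 0 < S.-1%:R :> R by rewrite ltr0n; lia.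
have SE : S%:R = S.-1%:R + 1 :> R by rewrite natr1 prednK//; lia.
rewrite /meanstep big_seq (eq_bigr (fun v =>
  (pairsum st g g - 2 * asum st g * g (st.2 v) + 2 * (g (st.2 v) * g (st.2 v)))
   / (S.-1%:R * S.-2%:R))); last first.
  by move=> v vT; rewrite /pairavg pairsum_freeze// size_actives_next.
rewrite -mulr_suml -big_seq big_split sumrB /= -!mulr_sumr.
rewrite big_const_seq count_predT iter_addr_0 -/S -(mulr_natr (pairsum _ _ _)).
rewrite -/(asum st g) -/(asum st (fun a => g a * g a)) /pairavg -/S.
have D0 := pairsum_ge0 st g0 g0.
have -> : asum st (fun a => g a * g a) = asum st g * asum st g - pairsum st g g.
  by rewrite /pairsum; ring.
set D := pairsum st g g in D0 *; set m := asum st g.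
have -> : D * S%:R - 2 * m * m + 2 * (m * m - D) = D * (S%:R - 2) by ring.
have [S2|S2] := ltnP 2 S; last first.
  have -> : S.-2%:R = 0 :> R by have -> : S.-2 = 0%N by lia.
  by rewrite mulr0 invr0 !mulr0; apply: divr_ge0.
have Q0 : 0 < S.-2%:R :> R by rewrite ltr0n; lia.
have PE : S.-1%:R = S.-2%:R + 1 :> R by rewrite natr1; congr _%:R; lia.
rewrite SE PE; set q := S.-2%:R in Q0 *.
by rewrite le_eqVlt; apply/orP; left; apply/eqP; field;
  do ?[apply/andP; split]; apply/eqP; lra.
Qed.

(** Two lineages behave as independent ones until they merge. *)
Theorem mean_pairavg z st g : pos (size (actives st.1)) (walk z) ->
  (forall a, 0 <= g a) ->
  mean z st (fun st' => pairavg st' g)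
  <= pairavg st (lineage (size (actives st.1)) z g)
     + asum st (merges (size (actives st.1)) z g) / (size (actives st.1))%:R.
Proof.
move=> + g0; elim: z st => [|[b u] z IH] st /=.
  by move=> _; rewrite asum_cst mul0r mul0r addr0.
set S := size _ => /andP[S0 pS].
have nS v : v \in actives st.1 ->
    size (actives (next (b, u) st v).1) = nxt S b.
  by move=> /size_actives_next ->.
set G := lineage (nxt S b) z g; set M := merges (nxt S b) z g.
have G0 a : 0 <= G a by exact: lineage_ge0.
apply: (@le_trans _ _ (meanstep (b, u) st (fun st' =>
   pairavg st' G + asum st' M / (size (actives st'.1))%:R))).
  by apply: meanstep_le => v vT; have := IH (next (b, u) st v); rewrite nS//; exact.
rewrite meanstepD.
have -> : meanstep (b, u) st (fun st' => asum st' M / (size (actives st'.1))%:R)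
    = asum st (lineage S [:: (b, u)] M) / S%:R.
  have := @mean_average [:: (b, u)] st M; rewrite -/S => <- //=.
  by rewrite S0 /=; have := pos_gt0 pS; case: (nxt S b).
case: b => /= in pS nS G M G0 *; last first.
  apply: lerD => //; apply: pairavg_freeze => //.
  by have := pos_gt0 pS; rewrite -/S; lia.
have H := pairavg_attach u S0 G0.
rewrite [X in _ <= _ + X / _]asumD mulrDl.
by rewrite [X in _ <= _ + X]addrC addrA lerD2r.
Qed.

End Moments.

(** * Record attachments *)

Section Records.
Context {R : realType}.
Variables (l0 : nat) (bar : nat -> R).

Definition label := (nat * option nat)%type.

(** The label [(d, Some c)] is that of a vertex of depth [d] whose ancestral line has [c]
    record edges; the second component is [None] once this number has crossed the
    barrier. *)
Definition child (m : option R) (a : label) : label :=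
  (a.1.+1,
   if m is Some beta then
     if a.2 is Some c then if c.+1%:R <= beta then Some c.+1 else None else None
   else a.2).

(** The future minimum of the walk started at [S]. *)
Fixpoint lev (S : nat) (x : seq bool) : nat :=
  if x is b :: x' then minn S (lev (nxt S b) x') else S.

(** An attachment leaving [S > l0] active vertices is a record if it is the last one to do
    so. Since the walk only goes up by [1], there is exactly one record at each level above
    [l0] and the future minimum, up to the final value: along the records, lineages are
    those of a random recursive tree. *)
Definition recordb (S : nat) (x : seq bool) : bool := (l0 < S)%N && (lev S x == S).

Fixpoint deco (S : nat) (x : seq bool) : seq (bool * (label -> label)) :=
  match x with
  | [::] => [::]
  | true :: x' =>
      (true, child (if recordb S.+1 x' then Some (bar S.+1) else None))
      :: deco S.+1 x'
  | false :: x' => (false, id) :: deco S.-1 x'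
  end.

Lemma walk_deco S x : [seq s.1 | s <- deco S x] = x.
Proof. by elim: x S => [|[] x IH] S //=; rewrite IH. Qed.

Lemma lev_le S x : (lev S x <= S)%N.
Proof. by case: x => [|b x] //=; exact: geq_minl. Qed.

Lemma lev_le_endS S x : (lev S x <= endS S x)%N.
Proof.
elim: x S => [|b x IH] S //=.
by apply: leq_trans (geq_minr _ _) _; exact: IH.
Qed.

Lemma lev_gt0 S x : pos S x -> (0 < lev S x)%N.
Proof.
elim: x S => [|b x IH] S /=; first by rewrite andbT.
by move=> /andP[S0 /IH]; rewrite leq_min S0.
Qed.

(** The mean of the increase of the depth of a uniform active vertex. *)
Fixpoint clock (S : nat) (x : seq bool) : R :=
  match x with
  | [::] => 0
  | true :: x' => S.+1%:R^-1 + clock S.+1 x'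
  | false :: x' => clock S.-1 x'
  end.

Fixpoint nonrec_clock (S : nat) (x : seq bool) : R :=
  match x with
  | [::] => 0
  | true :: x' => (if recordb S.+1 x' then 0 else S.+1%:R^-1) + nonrec_clock S.+1 x'
  | false :: x' => nonrec_clock S.-1 x'
  end.

Fixpoint nonrec_laplace (theta : R) (S : nat) (x : seq bool) : R :=
  match x with
  | [::] => 1
  | true :: x' =>
      (if recordb S.+1 x' then 1 else 1 - (1 - expR (- theta)) / S.+1%:R)
      * nonrec_laplace theta S.+1 x'
  | false :: x' => nonrec_laplace theta S.-1 x'
  end.

Lemma clock_ge0 S x : 0 <= clock S x.
Proof.
by elim: x S => [|[] x IH] S //=; rewrite addr_ge0// invr_ge0.
Qed.

Lemma nonrec_laplace_le theta S x : 0 <= theta ->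
  0 <= nonrec_laplace theta S x <= expR (- ((1 - expR (- theta)) * nonrec_clock S x)).
Proof.
move=> t0; elim: x S => [|[] x IH] S //=.
  by rewrite mulr0 oppr0 expR0 ler01 lexx.
have /andP[q0 qe] := IH S.+1.
have e1 : expR (- theta) <= 1 by rewrite expR_le1; lra.
have e0 := expR_gt0 (- theta).
case: ifP => _; first by rewrite mul1r add0r q0.
have i0 := @invS_ge0 R S; have i1 := @invS_le1 R S.
set i := S.+1%:R^-1 in i0 i1 *.
have f0 : 0 <= 1 - (1 - expR (- theta)) * i by have := mulr_ge0 (ltW e0) i0; lra.
rewrite mulr_ge0//= mulrDr opprD expRD; apply: ler_pM => //.
by apply: le_trans (expR_ge1Dx _); rewrite lexx.
Qed.

Lemma ln_succ_ge (n : nat) : (0 < n)%N -> n.+1%:R^-1 <= ln n.+1%:R - ln n%:R :> R.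
Proof.
move=> n0.
have n0' : 0 < n%:R :> R by rewrite ltr0n.
have n1' : 0 < n.+1%:R :> R by rewrite ltr0n.
have := @le_ln1Dx R (- n.+1%:R^-1).
have -> : 1 + - n.+1%:R^-1 = n%:R / n.+1%:R :> R.
  by rewrite -[in RHS](addrK 1 n%:R) natr1; field; rewrite lt0r_neq0.
rewrite ln_div ?posrE// => H.
suff : -1 < - n.+1%:R^-1 :> R.
  by move=> /H; set i := n.+1%:R^-1; set y := ln n.+1%:R; lra.
by rewrite ltrN2 invf_lt1// ltr1n ltnS.
Qed.

Lemma ln_succ_le (n : nat) : (0 < n)%N -> ln n.+1%:R - ln n%:R <= n%:R^-1 :> R.
Proof.
move=> n0.
have n0' : 0 < n%:R :> R by rewrite ltr0n.
have n1' : 0 < n.+1%:R :> R by rewrite ltr0n.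
have := @le_ln1Dx R (n%:R^-1).
have -> : 1 + n%:R^-1 = n.+1%:R / n%:R :> R.
  by rewrite -natr1; field; rewrite lt0r_neq0.
rewrite ln_div ?posrE//; apply.
by apply: lt_trans (_ : 0 < _); rewrite ?ltrN10 ?invr_gt0.
Qed.

Lemma ler_ln_nat (m n : nat) : (m <= n)%N -> ln m%:R <= ln n%:R :> R.
Proof.
case: m => [|m] mn; last first.
  by rewrite ler_ln ?posrE ?ltr0n ?ler_nat//; exact: leq_trans mn.
by case: n {mn} => [//|n]; rewrite ln0// ln_ge0// ler1n.
Qed.

(** There is one record at each level between [l0] and the last one, so that records use
    at most the part [ln (endS S x) - ln l0] of the clock. *)
Lemma nonrec_clock_ge S x : pos S x -> (0 < l0 <= endS S x)%N ->
  clock S x - (ln (endS S x)%:R - ln (maxn l0 (lev S x))%:R) <= nonrec_clock S x.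
Proof.
move=> + /andP[l00]; elim: x S => [|b x IH] S /=.
  by move=> _ /maxn_idPr ->; rewrite !subrr.
move=> /andP[S0 pS] lL; have := IH _ pS lL.
have := lev_gt0 pS; have := lev_le (nxt S b) x.
case: b pS lL => /= pS lL l1 l2; last first.
  by have /minn_idPr -> : (lev S.-1 x <= S)%N by lia.
have mono : ln (maxn l0 (minn S (lev S.+1 x)))%:R <= ln (maxn l0 (lev S.+1 x))%:R :> R.
  by apply: ler_ln_nat; lia.
rewrite /recordb; case: ifP => [|_]; last first.
  move: mono; set i := S.+1%:R^-1; set y := ln _; set y' := ln _; set y'' := ln _; lra.
move=> /andP[l3 /eqP ->].
have -> : maxn l0 S.+1 = S.+1 by lia.
have -> : maxn l0 (minn S S.+1) = S by lia.
by have := ln_succ_ge S0; set i := S.+1%:R^-1; set y := ln S.+1%:R; lra.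
Qed.

(** The probability that a lineage which has [c] record edges up to level [l = L - k]
    satisfies [good] at level [L], while its number of record edges at each level stays
    below [bar]. *)
Fixpoint survive (L : nat) (good : nat -> R) (k : nat) (c : nat) : R :=
  if k is k'.+1 then
    let l := (L - k')%N in
    if (l0 < l)%N then
      (1 - l%:R^-1) * survive L good k' c
      + l%:R^-1 * (if c.+1%:R <= bar l then survive L good k' c.+1 else 0)
    else survive L good k' c
  else good c.

(** [theta] weighs the non-record edges; [tilt 0 f] is [f] applied to the number of record
    edges, and vanishes beyond the barrier. *)
Definition tilt (theta : R) (f : nat -> R) (a : label) : R :=
  if a.2 is Some c then f c * expR (- (theta * (a.1%:R - c%:R))) else 0.

Lemma survive_ge0 L good k c : (forall c, 0 <= good c) -> 0 <= survive L good k c.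
Proof.
move=> g0; elim: k c => [|k IH] c //=; case: ifP => // lk.
have ll : (0 < L - k)%N by lia.
apply: addr_ge0; apply: mulr_ge0; rewrite ?IH ?invr_ge0//.
  by rewrite subr_ge0 invf_le1 ?ler1n// ltr0n.
by case: ifP.
Qed.

Lemma survive_low L good l c : (l <= l0 <= L)%N ->
  survive L good (L - l) c = survive L good (L - l0) c.
Proof.
move=> /andP[ll0 l0L].
have gen m : (l <= m <= l0)%N ->
    survive L good (L - l) c = survive L good (L - m) c.
  elim: m => [|m IH] /andP[]; first by rewrite leqn0 => /eqP ->.
  rewrite leq_eqVlt => /orP[/eqP -> //|lm ml0].
  rewrite IH; last lia.
  have -> : (L - m)%N = (L - m.+1).+1 by lia.
  rewrite /=; have -> : (L - (L - m.+1))%N = m.+1 by lia.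
  by rewrite ltnNge ml0.
by apply: gen; rewrite ll0 leqnn.
Qed.

(** Record and non-record edges are independent: the former are described by [survive],
    whatever the times of the records, and the latter by [nonrec_laplace]. *)
Lemma lineage_deco theta (good : nat -> R) S x a : pos S x ->
  lineage S (deco S x) (tilt theta good) a
  = nonrec_laplace theta S x * tilt theta (survive (endS S x) good (endS S x - lev S x)) a.
Proof.
elim: x S a => [|b x IH] S a /=; first by move=> _; rewrite subnn mul1r.
move=> /andP[S0 pS].
have l1 := lev_le (nxt S b) x; have l2 := lev_le_endS (nxt S b) x.
case: b pS l1 l2 => /= pS l1 l2; last first.
  by rewrite IH//; have /minn_idPr -> : (lev S.-1 x <= S)%N by lia.
rewrite !IH// /recordb; set L := endS _ _ in l2 *.
have SS0 : S.+1%:R != 0 :> R by rewrite pnatr_eq0.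
case: ifP => [/andP[l3 /eqP lE]|].
  rewrite !lE in l1 l2 *.
  have -> : minn S S.+1 = S by lia.
  have -> : (L - S)%N = (L - S.+1).+1 by lia.
  rewrite /tilt /child /=; have -> : (L - (L - S.+1))%N = S.+1 by lia.
  rewrite l3; case: a => d [c|] /=; last by rewrite !mulr0 addr0.
  case: ifP => _; last by ring.
  have -> : d.+1%:R - c.+1%:R = d%:R - c%:R :> R by rewrite -!natr1; ring.
  by ring.
move=> nrec.
have -> : survive L good (L - minn S (lev S.+1 x)) = survive L good (L - lev S.+1 x).
  case: (leqP (lev S.+1 x) S) => [//|lS].
  have lE : lev S.+1 x = S.+1 by lia.
  move: nrec; rewrite lE eqxx andbT => /negbT; rewrite -leqNgt => Sl0.
  have -> : (L - S)%N = (L - S.+1).+1 by lia.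
  apply/funext => c /=; have -> : (L - (L - S.+1))%N = S.+1 by lia.
  by rewrite ltnNge Sl0.
rewrite /tilt /child /=; case: a => d [c|] /=; last by rewrite !mulr0 addr0.
have -> : - (theta * (d.+1%:R - c%:R)) = - theta + - (theta * (d%:R - c%:R)) :> R.
  by rewrite -natr1; ring.
by rewrite expRD; ring.
Qed.

Lemma nonrec_laplace0 S x : nonrec_laplace 0 S x = 1.
Proof.
elim: x S => [|[] x IH] S //=.
by rewrite IH oppr0 expR0 subrr mul0r subr0 mulr1; case: ifP.
Qed.

Lemma lineage_deco0 (good : nat -> R) S x a : pos S x ->
  lineage S (deco S x) (tilt 0 good) a
  = tilt 0 (survive (endS S x) good (endS S x - lev S x)) a.
Proof. by move=> pS; rewrite lineage_deco// nonrec_laplace0 mul1r. Qed.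

Lemma tilt0E (f : nat -> R) d c : tilt 0 f (d, Some c) = f c.
Proof. by rewrite /tilt /= mul0r oppr0 expR0 mulr1. Qed.

Lemma tilt_ge0 theta (f : nat -> R) : (forall c, 0 <= f c) ->
  forall a, 0 <= tilt theta f a.
Proof. by move=> f0 [d [c|]] //; rewrite /tilt /= mulr_ge0// expR_ge0. Qed.

Section Second.
Variables (good : nat -> R) (w : R).
Hypothesis good_ge0 : forall c, 0 <= good c.
Hypothesis bar_mono : forall l l' : nat, (l <= l')%N -> bar l <= bar l'.
Hypothesis w_ge0 : 0 <= w.

Definition below (l : nat) (a : label) : Prop :=
  if a.2 is Some c then c%:R <= bar l else True.

(** A lineage which is below the barrier at level [l] survives with probability at most
    [w * l]. As [l] is at most the number of active vertices, merging at an attachment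
    leaving [s] active vertices, which has probability of order [s ^- 2], costs at most a
    constant times [w / s], and these terms sum up to the clock. *)
Lemma merges_deco S x a :
  pos S x -> (l0 <= lev S x)%N ->
  (forall l c, (l0 <= l <= endS S x)%N -> c%:R <= bar l ->
     survive (endS S x) good (endS S x - l) c <= w * l%:R) ->
  below (lev S x) a ->
  merges S (deco S x) (tilt 0 good) a
  <= 8 * w * clock S x * lineage S (deco S x) (tilt 0 good) a.
Proof.
elim: x S a => [|b x IH] S a /=; first by rewrite mulr0 mul0r.
move=> /andP[S0 pS] ll0 Hw ba.
have l1 := lev_le (nxt S b) x.
case: b pS l1 ll0 Hw ba => /= pS l1 ll0 Hw ba; last first.
  have lE : minn S (lev S.-1 x) = lev S.-1 x by lia.
  by rewrite lE in ll0 ba; exact: IH.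
have ll' : (minn S (lev S.+1 x) <= lev S.+1 x)%N by exact: geq_minr.
have l0l' : (l0 <= lev S.+1 x)%N by lia.
have ba' : below (lev S.+1 x) a.
  move: ba; rewrite /below; case: a.2 => // c cb.
  exact: le_trans cb (bar_mono ll').
set u := child _.
have bu : below (lev S.+1 x) (u a).
  rewrite /u /child /recordb /below /=; case: ifP => [/andP[_ /eqP lE]|_]; last exact: ba'.
  by case: a.2 => // c; case: ifP; rewrite // lE.
have Ma := IH S.+1 a pS l0l' Hw ba'; have Mu := IH S.+1 (u a) pS l0l' Hw bu.
set G := lineage _ _ _ in Ma Mu *; set M := merges _ _ _ in Ma Mu *.
have G0 c : 0 <= G c by apply: lineage_ge0 => c'; exact: tilt_ge0.
have Gu : G (u a) <= w * S.+1%:R.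
  have l0lL : (l0 <= lev S.+1 x <= endS S.+1 x)%N by rewrite l0l' lev_le_endS.
  rewrite /G lineage_deco0//; move: bu; case: (u a) => d [c|]; last first.
    by move=> _; rewrite /tilt /= mulr_ge0.
  rewrite /below /= => cb; rewrite tilt0E; apply: le_trans (Hw _ _ l0lL cb) _.
  by apply: ler_wpM2l => //; rewrite ler_nat.
have s0 : 0 < S%:R :> R by rewrite ltr0n.
have s1 : 1 <= S%:R :> R by rewrite ler1n.
have K0 := clock_ge0 S.+1 x; set K := clock _ _ in K0 Ma Mu *.
have Ga0 := G0 a; have Gu0 := G0 (u a).
have -> : S.+1%:R = S%:R + 1 :> R by rewrite natr1.
rewrite -natr1 in Gu.
set s := S%:R in s0 s1 Gu *; set ga := G a in Ma Ga0 *; set gu := G (u a) in Mu Gu Gu0 *.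
set P := (1 - (s + 1)^-1) * ga + (s + 1)^-1 * gu.
have i0 : 0 < (s + 1)^-1 by rewrite invr_gt0; lra.
have i1 : (s + 1)^-1 <= 1 by rewrite invf_le1; lra.
have H1 : (1 - (s + 1)^-1) * M a + (s + 1)^-1 * M (u a) <= 8 * w * K * P.
  have e1 : 0 <= 1 - (s + 1)^-1 by lra.
  have := ler_wpM2l e1 Ma; have := ler_wpM2l (ltW i0) Mu.
  by rewrite /P; lra.
have H2 : 2 / ((s + 1) * s) * (ga * gu) <= 8 * w * (s + 1)^-1 * P.
  have Pga : s / (s + 1) * ga <= P.
    have -> : P = s / (s + 1) * ga + (s + 1)^-1 * gu by rewrite /P; field; lra.
    by rewrite lerDl mulr_ge0// ltW.
  apply: (@le_trans _ _ (2 / ((s + 1) * s) * (ga * (w * (s + 1))))).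
    apply: ler_wpM2l; first by apply: divr_ge0 => //; rewrite mulr_ge0//; lra.
    exact: ler_wpM2l.
  apply: (@le_trans _ _ (8 * w * (s + 1)^-1 * (s / (s + 1) * ga))); last first.
    apply: ler_wpM2l => //; apply: mulr_ge0; last exact: ltW.
    exact: mulr_ge0.
  rewrite -subr_ge0.
  have -> : 8 * w / (s + 1) * (s / (s + 1) * ga) - 2 / ((s + 1) * s) * (ga * (w * (s + 1)))
     = 2 * w * ga * ((s - 1) * (3 * s + 1)) / ((s + 1) ^+ 2 * s).
    by field; apply/andP; split; apply/eqP; lra.
  apply: divr_ge0; last by rewrite mulr_ge0 ?exprn_ge0//; lra.
  by rewrite !mulr_ge0//; lra.
by move: H1 H2; rewrite /P; lra.
Qed.

Lemma clock_suffix b S x : clock (nxt S b) x <= clock S (b :: x).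
Proof. by case: b => //=; rewrite lerDr invr_ge0. Qed.

(** Before level [l0] the labels carry no information, so that merging costs nothing. *)
Lemma mean_pairavg_deco S x (st : labelled) (p := survive (endS S x) good (endS S x - l0) 0) :
  pos S x -> (lev S x <= l0 < endS S x)%N -> size (actives st.1) = S ->
  (forall v, v \in actives st.1 -> (st.2 v).2 = Some 0%N) ->
  0 <= bar l0 ->
  (forall l c, (l0 <= l <= endS S x)%N -> c%:R <= bar l ->
     survive (endS S x) good (endS S x - l) c <= w * l%:R) ->
  mean (deco S x) st (fun st' => pairavg st' (tilt 0 good))
  <= p ^+ 2 + 8 * w * clock S x * p.
Proof.
move=> + + + + bar0; rewrite /p {p}.
elim: x S st => [|b x IH] S st; first by move=> _ /=; lia.
move=> pS /andP[levl l0L] szS lab0 Hw.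
set p := survive _ _ _ 0.
have p0 : 0 <= p by exact: survive_ge0.
have [levE|levN] := eqVneq (lev S (b :: x)) l0; last first.
  rewrite -(@meanstep_cst R _ (head (false, id) (deco S (b :: x))) st (_ + _)); last first.
    by rewrite szS (pos_gt0 pS).
  have -> : deco S (b :: x) = head (false, id) (deco S (b :: x)) :: deco (nxt S b) x.
    by case: b {IH pS levl l0L Hw p p0 levN}.
  move: pS => /= /andP[S0 pS].
  rewrite [head _ _ in X in _ <= X](_ : _ = head (false, id) (deco S (b :: x)))//.
  have l1 := lev_le (nxt S b) x.
  have lx : (lev (nxt S b) x <= l0)%N.
    by move: levl levN l1; case: b {IH pS l0L Hw p p0} => /=; lia.
  apply: meanstep_le => v vT.
  apply: le_trans (IH (nxt S b) _ pS _ _ _ Hw) _.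
  - by rewrite lx.
  - by rewrite size_actives_next// szS; case: b {IH pS levl l0L Hw p p0 levN l1 lx}.
  - move=> w'; case: b {IH levl Hw p p0} pS l0L levN l1 lx => /= pS l0L levN l1 lx.
      rewrite /next /= actives_attach mem_rcons inE.
      case: eqP => [_ _|_ /= w'T]; last exact: lab0.
      rewrite /child /= lab0// /recordb; case: ifP => // /andP[l3 /eqP lE].
      by move: lx l3; rewrite lE; lia.
    rewrite /next /= /actives mem_filter /= => /andP[/andP[_ aw] wT].
    by apply: lab0; rewrite mem_filter aw.
  - rewrite -/p lerD2l; apply: ler_wpM2r => //; apply: ler_wpM2l; first by rewrite mulr_ge0.
    exact: clock_suffix.
have lE a : a.2 = Some 0%N -> lineage S (deco S (b :: x)) (tilt 0 good) a = p.
  move=> a2; rewrite lineage_deco// nonrec_laplace0 mul1r levE -/p.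
  by case: a a2 => d o /= ->; rewrite tilt0E.
apply: le_trans (mean_pairavg _ _) _; rewrite ?szS ?walk_deco//.
  by move=> a; exact: tilt_ge0.
have S0 := pos_gt0 pS.
have s0 : 0 < S%:R :> R by rewrite ltr0n.
apply: lerD.
  rewrite /pairavg /pairsum szS.
  have -> : asum st (lineage S (deco S (b :: x)) (tilt 0 good)) = p * S%:R.
    rewrite -[X in _ = _ * X%:R]szS -asum_cst /asum big_seq [RHS]big_seq.
    by apply: eq_bigr => v vT; rewrite lE// lab0.
  have -> : asum st (fun a => lineage S (deco S (b :: x)) (tilt 0 good) a
      * lineage S (deco S (b :: x)) (tilt 0 good) a) = p * p * S%:R.
    rewrite -[X in _ = _ * X%:R]szS -asum_cst /asum big_seq [RHS]big_seq.
    by apply: eq_bigr => v vT; rewrite lE// lab0.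
  have [S1|S1] := ltnP 1 S; last first.
    have -> : S.-1%:R = 0 :> R by have -> : S.-1 = 0%N by lia.
    by rewrite mulr0 invr0 mulr0 exprn_ge0.
  have P0 : 0 < S.-1%:R :> R by rewrite ltr0n; lia.
  have -> : S%:R = S.-1%:R + 1 :> R by rewrite natr1 prednK.
  rewrite le_eqVlt; apply/orP; left; apply/eqP.
  by set q := S.-1%:R in P0 *; field; do ?[apply/andP; split]; apply/eqP; lra.
rewrite ler_pdivrMr// -[X in _ <= _ * X%:R]szS -asum_cst.
apply: asum_le => v vT.
rewrite -(lE (st.2 v)) ?lab0//; apply: merges_deco => //; first by rewrite levE.
by rewrite levE /below lab0.
Qed.

End Second.

End Records.

(** * Depth and height *)

Lemma path_depth (V : eqType) (e : rel V) (d : V -> nat) (u : V) (p : seq V) :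
  (forall a b, e a b -> (d b <= (d a).+1)%N) -> path e u p ->
  (d (last u p) <= d u + size p)%N.
Proof.
move=> de; elim: p u => [|a p IH] u /=; first by rewrite addn0.
by move=> /andP[/de da /IH]; lia.
Qed.

Lemma gdist_ge (V : finType) (e : rel V) (d : V -> nat) (u v : V) :
  (forall a b, e a b -> (d b <= (d a).+1)%N) -> d u = 0%N -> (d v <= #|V|)%N ->
  (d v <= gdist e u v)%N.
Proof.
move=> de du dv; rewrite /gdist; set P := fun k => _.
have [hP|nP] := boolP (has P (iota 0 #|V|)); last first.
  by rewrite hasNfind// size_iota.
have := nth_find 0%N hP; have := hP; rewrite has_find size_iota => fV.
rewrite nth_iota// add0n => /existsP[p /andP[ep /eqP <-]].
rewrite -[X in (_ <= X)%N](size_tuple p).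
by have := path_depth de ep; rewrite du add0n.
Qed.

Section Depth.
Context {R : realType}.
Notation lstate := (@labelled (label)).

Definition deep (th : R) (st : lstate) : bool :=
  has (fun v => th <= (st.2 v).1%:R) (iota 0 (maxv st.1).+1).

(** What makes the first component of the labels a lower bound of the depth; the last
    condition is needed because [gdist] is bounded by the number of vertices. *)
Definition depthok (st : lstate) : Prop :=
  [/\ (st.2 0%N).1 = 0%N,
      forall a b, adj st.1 a b ->
        [/\ (a <= maxv st.1)%N, (b <= maxv st.1)%N & ((st.2 b).1 <= (st.2 a).1.+1)%N] &
      forall v, (v <= maxv st.1)%N -> ((st.2 v).1 <= v)%N].

Lemma mem_actives T v : v \in actives T -> (v <= maxv T)%N.
Proof. by rewrite mem_filter mem_iota => /andP[_]; lia. Qed.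

Lemma depthok_next (s : bool * (label -> label)) st v :
  (s.1 -> forall a, (s.2 a).1 = a.1.+1) -> depthok st -> v \in actives st.1 ->
  depthok (next s st v).
Proof.
move=> su [d0 dadj dle] /mem_actives vT; rewrite /next.
case: s su => -[] u /= su; last by split.
have {}su := su isT.
split => /= [|a b|w wT].
- by [].
- case/or3P => [/dadj[am bm dab]|/andP[/eqP -> /eqP ->]|/andP[/eqP -> /eqP ->]].
  + by rewrite !ifN_eq//; [split=> //; lia|lia|lia].
  + by rewrite eqxx ifN_eq ?su; [split=> //; lia|lia].
  + by rewrite eqxx ifN_eq ?su; [split=> //; lia|lia].
- case: eqP => [->|wN]; last by apply: dle; lia.
  by rewrite su; have := dle v vT; lia.
Qed.

Lemma deep_next th s st v : deep th st -> deep th (next s st v).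
Proof.
move=> /hasP[w]; rewrite mem_iota add0n => /= wT thw.
apply/hasP; exists w.
  by rewrite mem_iota add0n /next; case: s => -[] u /=; lia.
by rewrite /next; case: s => -[] u //=; rewrite ifN_eq//; lia.
Qed.

Lemma deep_height th st : depthok st -> deep th st -> th <= (height st.1)%:R.
Proof.
move=> [d0 dadj dle] /hasP[w]; rewrite mem_iota add0n => /= wT thw.
apply: (le_trans thw); rewrite ler_nat /height.
apply: leq_trans (leq_bigmax (Ordinal wT)).
apply: (@gdist_ge _ _ (fun v : 'I_(maxv st.1).+1 => (st.2 v).1) ord0 (Ordinal wT)).
- by move=> a b /dadj[].
- by [].
- by rewrite card_ord /=; have := dle w wT; lia.
Qed.

Definition root0 : lstate := (tree0, fun=> (0%N, Some 0%N)).

Lemma depthok0 : depthok root0.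
Proof. by split. Qed.

Lemma deco_depth l0 (bar : nat -> R) S x s :
  List.In s (deco l0 bar S x) -> s.1 -> forall a, (s.2 a).1 = a.1.+1.
Proof.
by elim: x S => [|[] x IH] S //= [<-|/IH].
Qed.

(** Unlike in [pos], the final value may be [0]. *)
Fixpoint live (S : nat) (x : seq bool) : bool :=
  if x is b :: x' then (0 < S)%N && live (nxt S b) x' else true.

(** The number of active vertices is deterministic. *)
Lemma mean_size (A : Type) (z : seq (bool * (A -> A))) st
    (phi : @labelled A -> nat -> R) :
  mean z st (fun st' => phi st' (size (actives st'.1)))
  = mean z st (fun st' => phi st' (endS (size (actives st.1)) [seq s.1 | s <- z])).
Proof.
elim: z st => //= s z IH st; rewrite /meanstep; congr (_ * _).
by rewrite big_seq [RHS]big_seq; apply: eq_bigr => v vT; rewrite IH size_actives_next.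
Qed.

Lemma mean_deep_cat th z1 z2 st :
  live (size (actives st.1)) [seq s.1 | s <- z1 ++ z2] ->
  mean z1 st (fun st' => (deep th st')%:R) <= mean (z1 ++ z2) st (fun st' => (deep th st')%:R) :> R.
Proof.
rewrite mean_cat; elim: z1 st => [|s z1 IH] st /=; last first.
  move=> /andP[_ lz]; apply: meanstep_le => v vT; apply: IH.
  by rewrite size_actives_next.
elim: z2 st => //= s z IH st /andP[S0 lz].
rewrite -[X in X <= _](@meanstep_cst R _ s st)//; apply: meanstep_le => v vT.
apply: (@le_trans _ _ (deep th (next s st v))%:R); last first.
  by apply: IH; rewrite size_actives_next.
by rewrite ler_nat; case E : (deep th st) => //=; rewrite deep_next.
Qed.

End Depth.

(** * Probability that some vertex is deep *)

Section Tail.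
Context {R : realType}.
Variables (l0 : nat) (bar : nat -> R) (good : pred nat).
Let goodR (c : nat) : R := (good c)%:R.

Let goodR_ge0 c : 0 <= goodR c. Proof. exact: ler0n. Qed.

Definition heavy (y : R) (a : label) : bool :=
  if a.2 is Some c then good c && (y <= a.1%:R - c%:R) else false.

Let avg st (f : label -> R) := asum st f / (size (actives st.1))%:R.

(** Markov's inequality for an exponential of the number of non-record edges. *)
Lemma heavy_ge (theta y : R) a : 0 <= theta ->
  tilt 0 goodR a - expR (theta * y) * tilt theta goodR a <= (heavy y a)%:R.
Proof.
move=> t0; case: a => d [c|]; last by rewrite /tilt /heavy /= mulr0 subr0.
rewrite tilt0E /tilt /heavy /= /goodR; case: (good c) => /=; last first.
  by rewrite mul0r mulr0 subr0.
rewrite mul1r -expRD; case: (leP y (d%:R - c%:R)) => [_|yd]; last first.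
  by rewrite /= mulr0n subr_le0; apply: le_trans (expR_ge1Dx _);
    have := ler_wpM2l t0 (ltW yd); lra.
by rewrite lerBlDr lerDl expR_ge0.
Qed.

Lemma avg_heavy_deep y h st : (forall c, good c -> h <= c%:R) ->
  avg st (fun a => (heavy y a)%:R) <= (deep (y + h) st)%:R.
Proof.
move=> gh; rewrite /avg.
have [S0|S0] := posnP (size (actives st.1)).
  by rewrite S0 invr0 mulr0 ler0n.
rewrite ler_pdivrMr ?ltr0n// -asum_cst; apply: asum_le => v vT.
rewrite ler_nat; case E: (heavy _ _) => //=.
move: E; rewrite /heavy; case E: (st.2 v).2 => [c|//] /andP[/gh hc yc].
rewrite lt0b; apply/hasP; exists v; first by rewrite mem_iota add0n /= ltnS mem_actives.
by lra.
Qed.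

Lemma mean_deep_first S x st (theta y h : R) (p := survive l0 bar (endS S x) goodR (endS S x - lev S x) 0) :
  pos S x -> size (actives st.1) = S -> S = 1%N ->
  (forall v, v \in actives st.1 -> st.2 v = (0%N, Some 0%N)) ->
  0 <= theta -> (forall c, good c -> h <= c%:R) ->
  p * (1 - expR (theta * y) * nonrec_laplace l0 theta S x)
  <= mean (deco l0 bar S x) st (fun st' => avg st' (fun a => (heavy y a)%:R)).
Proof.
move=> pS szS S1 lab0 t0 gh.
pose F th := mean (deco l0 bar S x) st (fun st' => avg st' (tilt th goodR)).
have FE th : F th = nonrec_laplace l0 th S x * p.
  rewrite /F mean_average szS ?walk_deco//.
  have -> : asum st (lineage S (deco l0 bar S x) (tilt th goodR))
      = nonrec_laplace l0 th S x * p * S%:R.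
    rewrite -[X in _ = _ * X%:R]szS -asum_cst /asum big_seq [RHS]big_seq.
    apply: eq_bigr => v vT; rewrite lineage_deco// lab0//.
    by rewrite /tilt /= subrr mulr0 oppr0 expR0 mulr1.
  by rewrite mulfK// pnatr_eq0 S1.
have -> : p * (1 - expR (theta * y) * nonrec_laplace l0 theta S x)
    = F 0 + - expR (theta * y) * F theta by rewrite !FE nonrec_laplace0; ring.
rewrite /F -meanZ -meanD; apply: mean_le => st'.
rewrite /avg mulrA -mulrDl; apply: ler_wpM2r; first by rewrite invr_ge0.
rewrite -asumZ -asumD; apply: asum_le => v vT.
by have := @heavy_ge theta y (st'.2 v) t0; rewrite mulNr.
Qed.

(** Second moment method. If no vertex is deep then the average [t] of [heavy y], divided
    by the survival probability [p], is [0], and otherwise [2 t - t ^ 2 <= 1]; hence the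
    probability is at least the mean of [2 t - t ^ 2]. The second moment is bounded
    without the condition on non-record edges. *)
Theorem mean_deep_second x (theta y h w : R)
    (p := survive l0 bar (endS 1 x) goodR (endS 1 x - l0) 0) :
  pos 1 x -> (0 < l0 < endS 1 x)%N -> 0 <= theta -> (forall c, good c -> h <= c%:R) ->
  (forall l l' : nat, (l <= l')%N -> bar l <= bar l') -> 0 <= w -> 0 <= bar l0 ->
  (forall l c, (l0 <= l <= endS 1 x)%N -> c%:R <= bar l ->
     survive l0 bar (endS 1 x) goodR (endS 1 x - l) c <= w * l%:R) ->
  0 < p ->
  1 - 2 * (expR (theta * y) * nonrec_laplace l0 theta 1 x)
    - (8 * w * clock 1 x / p + ((endS 1 x)%:R * p)^-1)
  <= mean (deco l0 bar 1 x) root0 (fun st => (deep (y + h) st)%:R).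
Proof.
move=> pS /andP[l00 l0L] t0 gh bmono w0 bar0 Hw p0.
set z := deco _ _ _ _; set L := endS 1 x in l0L Hw p p0 *.
have lev1 : lev 1 x = 1%N by have := lev_gt0 pS; have := lev_le 1 x; lia.
have pE : survive l0 bar L goodR (L - lev 1 x) 0 = p.
  by rewrite lev1 survive_low//; lia.
have sz0 : size (actives (@root0).1) = 1%N by [].
have lab0 v : v \in actives (@root0).1 -> (@root0).2 v = (0%N, Some 0%N) by [].
have walkz : [seq s.1 | s <- z] = x by exact: walk_deco.
pose Fy st := avg st (fun a => (heavy y a)%:R).
pose F st := avg st (tilt 0 goodR).
have L0 : 0 < L%:R :> R by rewrite ltr0n; lia.
have mFy : p * (1 - expR (theta * y) * nonrec_laplace l0 theta 1 x) <= mean z root0 Fy.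
  by have := @mean_deep_first 1 x root0 theta y h pS sz0 erefl lab0 t0 gh; rewrite -/L pE.
have mF : mean z root0 F = p.
  rewrite /F mean_average ?walkz// sz0 /asum /= big_seq1 /z lineage_deco0//.
  by rewrite -/L tilt0E pE divr1.
have m2 : mean z root0 (fun st => pairavg st (tilt 0 goodR)) <= p ^+ 2 + 8 * w * clock 1 x * p.
  by apply: mean_pairavg_deco => //; rewrite lev1 -/L l00 l0L.
have key st : 2 / p * Fy st + - (p ^- 2) * (pairavg st (tilt 0 goodR)
     + (size (actives st.1))%:R^-1 * F st) <= (deep (y + h) st)%:R.
  have Fy0 : 0 <= Fy st by rewrite /Fy divr_ge0//; apply: asum_ge0 => a; exact: ler0n.
  have FyF : Fy st <= F st.
    rewrite /Fy /F /avg; apply: ler_wpM2r; first by rewrite invr_ge0.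
    apply: asum_le => v _; case: (st.2 v) => d [c|]; last by rewrite /tilt /heavy.
    by rewrite tilt0E /heavy /= ler_nat; case: (good c) => //=; exact: leq_b1.
  have F2 : F st ^+ 2 <= pairavg st (tilt 0 goodR) + (size (actives st.1))%:R^-1 * F st.
    rewrite /F /avg /pairavg /pairsum.
    have -> : asum st (fun a => tilt 0 goodR a * tilt 0 goodR a) = asum st (tilt 0 goodR).
      apply: eq_asum => -[d [c|]]; last by rewrite /tilt /= mulr0.
      by rewrite !tilt0E /goodR; case: (good c); rewrite ?mulr1 ?mulr0.
    have [S0|S0] := posnP (size (actives st.1)).
      by rewrite S0 invr0 !mul0r invr0 !mulr0 expr0n addr0.
    set n := size _ in S0 *; set m := asum _ _.
    have m0 : 0 <= m by apply: asum_ge0 => a; exact: tilt_ge0.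
    have n0 : 0 < n%:R :> R by rewrite ltr0n.
    have [S1|S1] := ltnP 1 n; last first.
      have n1 : n = 1%N by apply/eqP; rewrite eqn_leq S1 S0.
      have pz : m * m - m = 0.
        rewrite /m /asum; move: n1; rewrite /n; case: (actives st.1) => [//|v [|//]] _.
        rewrite !big_seq1; case: (st.2 v) => d [c|]; last by rewrite /tilt /= mulr0 subrr.
        by rewrite !tilt0E /goodR; case: (good c); rewrite ?mulr1 ?mulr0 subrr.
      rewrite pz n1 mul0r add0r invr1 mul1r mulr1 expr2.
      by move: pz; lra.
    have q0 : 0 < n.-1%:R :> R by rewrite ltr0n -ltnS prednK.
    have -> : n%:R = n.-1%:R + 1 :> R by rewrite natr1 prednK.
    have mm : 0 <= m * m - m.
      have t1 a : 0 <= tilt 0 goodR a by exact: tilt_ge0.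
      have := asum_mul_ge st t1 t1; rewrite -/m subr_ge0; apply: le_trans.
      apply: asum_le => v _; case: (st.2 v) => d [c|]; last by rewrite /tilt /= mulr0.
      by rewrite !tilt0E /goodR; case: (good c); rewrite ?mulr1 ?mulr0.
    set q := n.-1%:R in q0 *.
    rewrite -subr_ge0.
    have -> : (m * m - m) / ((q + 1) * q) + (q + 1)^-1 * (m / (q + 1)) - (m / (q + 1)) ^+ 2
        = (m * m - m) / ((q + 1) ^+ 2 * q).
      by field; do ?[apply/andP; split]; apply/eqP; lra.
    by apply: divr_ge0 => //; rewrite mulr_ge0 ?exprn_ge0//; lra.
  set U := pairavg _ _ + _ in F2 *.
  have i0 : 0 < p^-1 by rewrite invr_gt0.
  rewrite -exprVn; set i := p^-1 in i0 *.
  have i2 : 0 <= i ^+ 2 by rewrite exprn_ge0// ltW.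
  have iU := ler_wpM2l i2 F2.
  have [D|D] := boolP (deep (y + h) st).
    have : 0 <= (1 - i * F st) ^+ 2 by rewrite sqr_ge0.
    have := ler_wpM2l (ltW i0) FyF.
    by move: iU; rewrite /= !expr2; lra.
  have Fy00 : Fy st = 0.
    apply/eqP; rewrite eq_le Fy0 andbT.
    have := @avg_heavy_deep y h st gh.
    by rewrite (negbTE D).
  have : 0 <= i ^+ 2 * F st ^+ 2 by rewrite mulr_ge0// exprn_ge0// (le_trans Fy0).
  by move: iU; rewrite Fy00 /=; lra.
apply: (le_trans _ (@mean_le R _ z root0 _ _ key)).
rewrite meanD !meanZ meanD.
rewrite (mean_size z root0 (fun st n => n%:R^-1 * F st)) meanZ mF sz0 walkz -/L.
set X := mean z root0 Fy in mFy *.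
set Y := mean z root0 _ in m2 *.
set e := expR (theta * y) * nonrec_laplace l0 theta 1 x in mFy *.
set K := 8 * w * clock 1 x in m2 *.
have i0 : 0 < p^-1 by rewrite invr_gt0.
have i2 : 0 <= p^-1 ^+ 2 by rewrite exprn_ge0// ltW.
have H1 := ler_wpM2l (ltW i0) mFy; have H2 := ler_wpM2l i2 m2.
have E1 : p^-1 * (p * (1 - e)) = 1 - e by field; apply/eqP; lra.
have E2 : p^-1 ^+ 2 * (p ^+ 2 + K * p) = 1 + K / p by field; apply/eqP; lra.
rewrite -exprVn invfM.
rewrite {}E1 in H1; rewrite {}E2 in H2.
have E3 : p^-1 ^+ 2 * (L%:R^-1 * p) = L%:R^-1 * p^-1.
  by field; do ?[apply/andP; split]; apply/eqP; lra.
rewrite mulNr mulrDr E3.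
by move: H1 H2; set i := p^-1; lra.
Qed.

(** With no constraint on the records, the first moment is enough. *)
Theorem mean_deep_typical x (theta y : R) :
  pos 1 x -> (forall c, good c) -> (endS 1 x <= l0)%N -> 0 <= theta ->
  1 - expR (theta * y) * nonrec_laplace l0 theta 1 x
  <= mean (deco l0 bar 1 x) root0 (fun st => (deep y st)%:R).
Proof.
move=> pS gt Ll0 t0.
have g0 c : good c -> 0 <= c%:R :> R by move=> _; exact: ler0n.
have := @mean_deep_first 1 x root0 theta y 0 pS erefl erefl _ t0 g0.
have one k c : survive l0 bar (endS 1 x) goodR k c = 1.
  elim: k c => [|k IH] c /=; first by rewrite /goodR gt.
  by rewrite ltnNge (leq_trans (leq_subr _ _) Ll0) /= IH.
rewrite one mul1r => H; apply: le_trans (H _) _ => //.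
apply: mean_le => st; rewrite -[X in deep X]addr0.
exact: avg_heavy_deep.
Qed.

End Tail.

(** * Survival of a lineage below a line *)

Section Ballot.
Context {R : realType}.
Implicit Types (t d S : R) (n k h : nat).

Notation e := (expR 1 : R).

Lemma e_ge2 : 2 <= e.
Proof. by have := @expR_ge1Dx R 1; lra. Qed.

Lemma e_gt0 : 0 < e. Proof. exact: expR_gt0. Qed.

(** Abel polynomials, as in the enumeration of parking functions: for [0 < n] the
    derivative of [ballot n.+1] is [ballot n], which vanishes on the line [n = e * t]. Up to
    the probability of no jump, they solve the backward equation of a Poisson process which
    has [n] jumps left to make in time [t] and is killed when it crosses this line. *)
Definition ballot n t : R := (n%:R / e - t) * t ^+ n.-1 / n`!%:R.

Lemma subX_factor t d k : 0 <= t -> 0 <= d ->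
  exists2 Q, 0 <= Q <= k.+1%:R * (t + d) ^+ k &
             (t + d) ^+ k.+1 - t ^+ k.+1 = d * Q.
Proof.
move=> t0 d0; elim: k => [|k [Q /andP[Q0 Qk] QE]].
  by exists 1; [rewrite mulr1 ler01 lexx|rewrite !expr1 addrC addKr mulr1].
have td : 0 <= (t + d) ^+ k.+1 by rewrite exprn_ge0// addr_ge0.
exists ((t + d) ^+ k.+1 + t * Q); last first.
  by rewrite mulrDr [d * (t * Q)]mulrCA -QE exprS [t ^+ k.+2]exprS; ring.
rewrite addr_ge0 ?mulr_ge0//= -(natr1 k.+1) mulrDl mul1r addrC lerD2r.
apply: (@le_trans _ _ ((t + d) * (k.+1%:R * (t + d) ^+ k))).
  by apply: ler_pM => //; rewrite lerDl.
by rewrite exprS mulrCA.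
Qed.

(** The discrete form of [(ballot n)' = ballot n.-1] on the allowed side of the line;
    [del] pays for the discretization. *)
Lemma ballot_step n t d m del : (0 < n)%N -> 1 <= t -> 0 <= d -> 0 < m ->
  0 <= del < 1 -> m * d <= 1 - del -> (1 - del) * (1 + d) ^+ n <= 1 ->
  m * (ballot n (t + d) - ballot n t) <= Num.max 0 (ballot n.-1 t).
Proof.
move=> n0 t1 d0 m0 /andP[del0 del1] md dn.
case: n n0 dn => [//|[|k]] _ dn.
  rewrite /ballot /= !expr0 fact0 (_ : 1`! = 1%N)// !divr1 !mulr1.
  apply: (@le_trans _ _ 0); last by rewrite le_max lexx.
  by have := mulr_ge0 (ltW m0) d0; lra.
have t0 : 0 <= t by lra.
have [Q /andP[Q0 Qk] QE] := subX_factor k t0 d0.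
have fn0 : 0 < k.+2`!%:R :> R by rewrite ltr0n fact_gt0.
set br := k.+1%:R / e - t.
have nE : k.+2%:R = k.+1%:R + 1 :> R by rewrite natr1.
have k10 : 0 < k.+1%:R :> R by [].
have td0 : 0 <= (t + d) ^+ k by rewrite exprn_ge0// addr_ge0.
have main : (k.+2%:R / e - (t + d)) * (t + d) ^+ k.+1 - (k.+2%:R / e - t) * t ^+ k.+1
     <= d * (Q * (k.+2%:R / k.+1%:R) * br).
  have -> : (k.+2%:R / e - (t + d)) * (t + d) ^+ k.+1 - (k.+2%:R / e - t) * t ^+ k.+1
     = d * ((k.+2%:R / e - t) * Q - (t + d) ^+ k.+1).
    rewrite mulrBr mulrCA -QE; ring.
  apply: ler_wpM2l => //.
  have : t * Q <= k.+1%:R * (t + d) ^+ k.+1.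
    rewrite exprS mulrCA; apply: ler_pM => //; lra.
  rewrite -ler_pdivrMl// => tQ.
  apply: (@le_trans _ _ ((k.+2%:R / e - t) * Q - k.+1%:R^-1 * (t * Q))).
    by rewrite lerD2l lerN2.
  rewrite le_eqVlt; apply/orP; left; apply/eqP; rewrite /br nE.
  by field; rewrite !lt0r_neq0// e_gt0.
have facE : k.+2`!%:R = k.+2%:R * k.+1`!%:R :> R by rewrite factS natrM.
have f0 : 0 < k.+1`!%:R :> R by rewrite ltr0n fact_gt0.
have -> : m * (ballot k.+2 (t + d) - ballot k.+2 t)
   = m * ((k.+2%:R / e - (t + d)) * (t + d) ^+ k.+1 - (k.+2%:R / e - t) * t ^+ k.+1)
     / k.+2`!%:R by rewrite /ballot /=; ring.
apply: (@le_trans _ _ (m * (d * (Q * (k.+2%:R / k.+1%:R) * br)) / k.+2`!%:R)).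
  by apply: ler_wpM2r; [rewrite invr_ge0 ltW|apply: ler_wpM2l => //; exact: ltW].
have [br0|br0] := leP br 0.
  apply: (@le_trans _ _ 0); last by rewrite le_max lexx.
  apply: mulr_le0_ge0; last by rewrite invr_ge0 ltW.
  apply: mulr_ge0_le0; first exact: ltW.
  apply: mulr_ge0_le0 => //; apply: mulr_ge0_le0 => //.
  by apply: mulr_ge0.
rewrite le_max; apply/orP; right.
rewrite /ballot /= -/br ler_pdivlMr//.
have -> : m * (d * (Q * (k.+2%:R / k.+1%:R) * br)) / k.+2`!%:R * k.+1`!%:R
    = (m * d) * (Q / k.+1%:R) * br.
  rewrite facE; field; rewrite !lt0r_neq0//.
have QQ : Q / k.+1%:R <= (t + d) ^+ k by rewrite ler_pdivrMr// mulrC.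
have QQ0 : 0 <= Q / k.+1%:R by exact: divr_ge0.
rewrite mulrC; apply: ler_wpM2l; first exact: ltW.
apply: (@le_trans _ _ ((1 - del) * (t + d) ^+ k)).
  by apply: ler_pM => //; rewrite mulr_ge0// ltW.
have tk0 : 0 <= t ^+ k by exact: exprn_ge0.
apply: (@le_trans _ _ ((1 - del) * (t ^+ k * (1 + d) ^+ k))).
  apply: ler_wpM2l; first lra.
  rewrite -exprMn; apply: lerXn2r; rewrite ?nnegrE; first lra.
    by apply: mulr_ge0; lra.
  by rewrite mulrDr mulr1 lerD2l ler_peMl.
rewrite mulrCA -[leRHS]mulr1; apply: ler_wpM2l => //.
apply: le_trans dn; apply: ler_wpM2l; first lra.
by apply: ler_weXn2l; [rewrite lerDl|exact: leqW (leqnSn k)].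
Qed.

(** The difference has the derivative [1 - expR (- v) * (1 + v)], which is nonnegative. *)
Lemma expRN_pade (u : R) : 0 <= u -> 2 - u <= expR (- u) * (2 + u).
Proof.
move=> u0.
pose f (v : R) := expR (- v) * (2 + v) - (2 - v).
have df (v : R) : is_derive v 1 f (1 - expR (- v) * (1 + v)).
  by apply: is_derive_eq; rewrite /GRing.scale /=; ring.
have f0 : f 0 <= f u.
  apply: (@ger0_derive1_ndecry R f 0) => //.
  - move=> v; rewrite in_itv /= andbT => v0.
    rewrite derive1E derive_val subr_ge0 -ler_pdivlMl ?expR_gt0// expRN invrK mulr1.
    exact: expR_ge1Dx.
  - apply: continuous_subspaceT => v.
    by apply/differentiable_continuous/derivable1_diffP; exact: ex_derive.
by move: f0; rewrite /f oppr0 expR0; lra.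
Qed.

(** The remainder of Stirling's formula is monotone. *)
Lemma stirling_step (n : nat) : (0 < n)%N ->
  1 <= (n%:R + 2^-1) * (ln n.+1%:R - ln n%:R) :> R.
Proof.
move=> n0.
have n0' : 0 < n%:R :> R by rewrite ltr0n.
have n1' : 0 < n.+1%:R :> R by rewrite ltr0n.
set y : R := (n%:R + 2^-1)^-1.
have y0 : 0 < y by rewrite invr_gt0; lra.
suff H : y <= ln n.+1%:R - ln n%:R.
  have y1 : (n%:R + 2^-1) * y = 1 by rewrite /y divff//; apply/eqP; lra.
  by apply: (@le_trans _ _ ((n%:R + 2^-1) * y)); [rewrite y1|apply: ler_wpM2l => //; lra].
rewrite -ln_div ?posrE// -[leLHS]expRK ler_ln ?posrE ?expR_gt0 ?divr_gt0//.
have := expRN_pade (ltW y0); rewrite expRN mulrC ler_pdivlMr ?expR_gt0// => H.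
rewrite ler_pdivlMr//.
have yE : y * (2 * n%:R + 1) = 2 by rewrite /y; field; apply/eqP; lra.
have n21 : 0 <= 2 * n%:R + 1 :> R by lra.
have := ler_wpM2r n21 H.
have -> : (2 - y) * expR y * (2 * n%:R + 1) = (2 * (2 * n%:R + 1) - y * (2 * n%:R + 1)) * expR y by ring.
have -> : (2 + y) * (2 * n%:R + 1) = 2 * (2 * n%:R + 1) + y * (2 * n%:R + 1) by ring.
by rewrite yE -natr1; lra.
Qed.

Lemma ln_fact_le (n : nat) : (0 < n)%N ->
  ln n`!%:R <= 1 + (n%:R + 2^-1) * ln n%:R - n%:R :> R.
Proof.
elim: n => [//|[|n] IH] _; first by rewrite (_ : 1`! = 1%N)// ln1; lra.
have n0 : 0 < n.+1%:R :> R by [].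
have n1 : 0 < n.+2%:R :> R by [].
rewrite factS natrM lnM ?posrE ?ltr0n ?fact_gt0//.
have := IH isT; have := @stirling_step n.+1 isT.
rewrite -(natr1 n.+1); set a := ln (n.+1%:R + 1); set b := ln n.+1%:R.
by set c := ln _; lra.
Qed.

(** At slope [e] the exponential factors of [t ^ n / n!] cancel, and what remains is the
    power [t ^ (- 3 / 2)] of the ballot theorem. *)
Lemma ballot_ge n t : 1 <= t -> 1 <= n%:R / e - t -> n%:R <= e * t + 4 ->
  expR (- 14 - ln t - ln n%:R / 2) <= ballot n t.
Proof.
move=> t1 tn nt.
have e2 := e_ge2.
have t0 : 0 < t by lra.
have n0 : 0 < n%:R :> R.
  by rewrite -(@pmulr_rgt0 _ e^-1) ?invr_gt0 ?e_gt0// mulrC; lra.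
have nn0 : (0 < n)%N by rewrite -(ltr0n R).
rewrite /ballot; have f0 : 0 < n`!%:R :> R by rewrite ltr0n fact_gt0.
apply: (@le_trans _ _ (t ^+ n.-1 / n`!%:R)); last first.
  apply: ler_wpM2r; first by rewrite invr_ge0 ltW.
  by apply: ler_peMl => //; apply: exprn_ge0; lra.
rewrite -[leRHS]lnK ?posrE ?divr_gt0 ?exprn_gt0// ler_expR.
rewrite ln_div ?posrE ?exprn_gt0// lnXn// -(mulr_natl (ln t)).
have := ln_fact_le nn0.
have -> : n.-1%:R = n%:R - 1 :> R by rewrite -[in RHS](prednK nn0) -natr1 addrK.
set F := ln n`!%:R.
have et0 : 0 < e * t by rewrite mulr_gt0// e_gt0.
have H : ln n%:R - ln t - 1 <= 4 / (e * t).
  have := @le_ln1Dx R (n%:R / (e * t) - 1).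
  have -> : 1 + (n%:R / (e * t) - 1) = n%:R / (e * t) by rewrite addrC subrK.
  rewrite ln_div ?posrE// lnM ?posrE ?e_gt0// expRK.
  have q0 : 0 < n%:R / (e * t) by exact: divr_gt0.
  have -> : -1 < n%:R / (e * t) - 1 by lra.
  move=> /(_ isT) HH.
  have : n%:R / (e * t) <= 1 + 4 / (e * t).
    by rewrite ler_pdivrMr// mulrDl mul1r divfK// lt0r_neq0.
  by move: HH; lra.
have H2 : n%:R * (4 / (e * t)) <= 12.
  apply: (@le_trans _ _ ((e * t + 4) * (4 / (e * t)))).
    by apply: ler_wpM2r => //; rewrite divr_ge0// ltW.
  rewrite mulrA ler_pdivrMr//.
  have : 2 * 1 <= e * t by apply: ler_pM.
  lra.
have := ler_wpM2l (ltW n0) H.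
set y := ln n%:R; set z := ln t; move: H2; set w := 4 / _.
have z0 : 0 <= z by exact: ln_ge0.
rewrite !mulrBr.
by lra.
Qed.

Section Survival.
Variables (L l0 h nm : nat) (del eta : R).
Hypothesis l00 : (0 < l0)%N.
Hypothesis l0L : (l0 < L)%N.
Hypothesis del01 : 0 <= del < 1.

(** The clock which remains at level [l]. The [1] keeps it away from [0], where [ballot]
    would vary too fast, and [1 - del] is the discretization factor of [ballot_step]. *)
Definition clk (l : nat) : R := 1 + (1 - del) * (ln L%:R - ln l%:R).
Definition barrier (l : nat) : R := h%:R - e * clk l.
Definition closeby : pred nat := fun c => (h <= c + nm)%N.

Notation surv := (survive l0 barrier L (fun c => (closeby c)%:R)).

(** Chernoff bound at the exponent [1]. *)
Lemma survive_le_exp k c : (k <= L - l0)%N ->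
  surv k c <= expR (c%:R + nm%:R - h%:R + (e - 1) * (ln L%:R - ln (L - k)%:R)).
Proof.
elim: k c => [|k IH] c kL.
  rewrite subn0 subrr mulr0 addr0 /= /closeby.
  case: leqP => hc; last exact: expR_ge0.
  apply: le_trans (expR_ge1Dx _); rewrite -(natrD R) lerDl subr_ge0 ler_nat.
  exact: hc.
have lk : (l0 < L - k)%N by lia.
rewrite /= lk; set l := (L - k)%N in lk *.
have lE : l = (L - k.+1).+1 by rewrite /l; lia.
set E := expR _.
have kL' : (k <= L - l0)%N by lia.
have : l%:R^-1 <= ln l%:R - ln (L - k.+1)%:R :> R.
  by rewrite lE; apply: ln_succ_ge; clear -l00 kL; lia.
set D := ln l%:R - _ => HD.
have i0 : 0 <= l%:R^-1 :> R by rewrite invr_ge0.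
have i1 : l%:R^-1 <= 1 :> R by rewrite invf_le1 ?ler1n ?ltr0n//; lia.
have E0 : 0 < E by exact: expR_gt0.
set U := expR (c%:R + nm%:R - h%:R + (e - 1) * (ln L%:R - ln l%:R)).
have U0 : 0 < U by exact: expR_gt0.
have Hc : surv k c <= U by exact: IH.
have Hc1 : (if c.+1%:R <= barrier l then surv k c.+1 else 0) <= U * e.
  case: ifP => _; last by rewrite mulr_ge0 ?ltW// e_gt0.
  apply: le_trans (IH _ kL') _; rewrite -/l /U -expRD ler_expR -natr1; lra.
apply: (@le_trans _ _ ((1 - l%:R^-1) * U + l%:R^-1 * (U * e))).
  by apply: lerD; apply: ler_wpM2l => //; rewrite subr_ge0.
have -> : E = U * expR ((e - 1) * D).
  by rewrite /E /U -expRD /D; congr expR; ring.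
have -> : (1 - l%:R^-1) * U + l%:R^-1 * (U * e) = U * (1 + (e - 1) * l%:R^-1) by ring.
apply: ler_wpM2l; first exact: ltW.
apply: le_trans (expR_ge1Dx _); rewrite lerD2l; exact: ler_wpM2l.
Qed.

Lemma clk_ge1 l : (0 < l <= L)%N -> 1 <= clk l.
Proof.
move=> /andP[l_gt0 lL]; rewrite /clk lerDl; apply: mulr_ge0; first by case/andP: del01; lra.
by rewrite subr_ge0; exact: ler_ln_nat.
Qed.

Lemma barrier_mono (l l' : nat) : (l <= l')%N -> barrier l <= barrier l'.
Proof.
move=> ll'; rewrite /barrier lerD2l lerN2; apply: ler_wpM2l; first exact: ltW e_gt0.
rewrite /clk lerD2l; apply: ler_wpM2l; first by case/andP: del01; lra.
by rewrite lerD2l lerN2; exact: ler_ln_nat.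
Qed.

(** At the barrier the Chernoff bound is [l / L], up to [expR nm]. *)
Lemma survive_le l c : del * (ln L%:R - ln l0%:R) <= 1 -> (l0 <= l <= L)%N ->
  c%:R <= barrier l -> surv (L - l) c <= expR nm%:R / L%:R * l%:R.
Proof.
move=> dl1 /andP[l0l lL] cb.
apply: le_trans (survive_le_exp _ _) _; first lia.
have -> : (L - (L - l))%N = l by lia.
have L0 : 0 < L%:R :> R by rewrite ltr0n; lia.
have l'0 : 0 < l%:R :> R by rewrite ltr0n; lia.
have lnl : ln l%:R <= ln L%:R :> R by apply: ler_ln_nat; lia.
have lnl0 : ln l0%:R <= ln l%:R :> R by exact: ler_ln_nat.
rewrite -[l%:R in leRHS]lnK ?posrE// -{2}[L%:R]lnK ?posrE// -expRN -!expRD ler_expR.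
move: cb; rewrite /barrier /clk.
set a := ln l%:R in lnl lnl0 *; set b := ln L%:R in dl1 lnl *.
case/andP: del01 => d0 d1 cb.
have : del * (b - a) <= 1.
  by apply: le_trans dl1; apply: ler_wpM2l => //; rewrite lerD2l lerN2.
move: cb; have := e_ge2; set E := expR 1 => E2; set q := del * (b - a) => + q1.
have -> : (1 - del) * (b - a) = (b - a) - q by rewrite /q; ring.
have E0 : 0 <= E by lra.
have := ler_wpM2l E0 q1.
by rewrite !mulrDr; lra.
Qed.

Hypothesis slack : (1 - del) * (1 + l0%:R^-1) ^+ h <= 1.
Hypothesis eta0 : 0 <= eta.
Hypothesis close_le : forall n, (n <= nm)%N -> ballot n 1 <= 1.
Hypothesis far_le : forall n, (nm < n)%N -> ballot n 1 <= eta * expR (- n%:R).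

(** The factor [l / L] is the probability of no jump from level [l] to level [L]. The
    second term, which is a supersolution, removes the endpoints of [ballot] which are
    more than [nm] below [h]. *)
Definition subsol (l c : nat) : R :=
  l%:R / L%:R * ballot (h - c) (clk l)
  - eta * expR (c%:R - h%:R + (e - 1) * (ln L%:R - ln l%:R)).

Lemma ballot_le0 n t : 0 <= t -> n%:R / e <= t -> ballot n t <= 0.
Proof.
move=> t0 nt; rewrite /ballot -mulrA; apply: mulr_le0_ge0; first by lra.
by rewrite mulr_ge0 ?exprn_ge0 ?invr_ge0.
Qed.

Lemma subsol_le_survive k c : (k <= L - l0)%N -> subsol (L - k) c <= surv k c.
Proof.
have L0 : 0 < L%:R :> R by rewrite ltr0n; lia.
elim: k c => [|k IH] c kL.
  rewrite subn0 /subsol /clk subrr !mulr0 !addr0 divff ?lt0r_neq0// mul1r /=.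
  rewrite /closeby.
  have [hc|hc] := leqP h (c + nm).
    apply: (@le_trans _ _ (ballot (h - c) 1)).
      by rewrite gerBl mulr_ge0 ?expR_ge0.
    by apply: close_le; lia.
  rewrite subr_le0; apply: le_trans (far_le _) _; first lia.
  apply: ler_wpM2l => //; rewrite ler_expR natrB; last lia.
  by rewrite opprB.
have surv0 k' c' : 0 <= surv k' c' by apply: survive_ge0 => ?; exact: ler0n.
have sub_le l' c' : ballot (h - c') (clk l') <= 0 -> subsol l' c' <= 0.
  move=> b0; rewrite /subsol subr_le0; apply: (@le_trans _ _ 0).
    by apply: mulr_ge0_le0 => //; exact: divr_ge0.
  by rewrite mulr_ge0 ?expR_ge0.
have lk : (l0 < L - k)%N by lia.
have kL' : (k <= L - l0)%N by lia.
have [b0|b0] := leP (ballot (h - c) (clk (L - k.+1))) 0.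
  exact: le_trans (sub_le _ _ b0) (surv0 _ _).
set m := (L - k.+1)%N in b0 *.
have m0 : (0 < m)%N by rewrite /m; lia.
have m0' : 0 < m%:R :> R by rewrite ltr0n.
have lE : (L - k)%N = m.+1 by rewrite /m; lia.
rewrite /= lE; rewrite lE in lk IH; rewrite lk.
have mL : (m.+1 <= L)%N by lia.
have l0m : (l0 <= m)%N by lia.
have hc0 : (0 < h - c)%N.
  rewrite lt0n; apply/eqP => h0; move: b0; rewrite h0 ltNge => /negP; apply.
  apply: ballot_le0; rewrite ?mul0r; apply: le_trans (clk_ge1 _) => //; lia.
have t1 : 1 <= clk m.+1 by apply: clk_ge1; lia.
pose d : R := (1 - del) * (ln m.+1%:R - ln m%:R).
have clkE : clk m = clk m.+1 + d by rewrite /clk /d; ring.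
have d1' : 0 <= 1 - del by case/andP: del01; lra.
have lnm : ln m%:R <= ln m.+1%:R :> R by exact: ler_ln_nat.
have d0 : 0 <= d by apply: mulr_ge0 => //; rewrite subr_ge0.
have dm : d <= (1 - del) * m%:R^-1 by apply: ler_wpM2l => //; exact: ln_succ_le.
have md : m%:R * d <= 1 - del.
  by have := ler_wpM2l (ltW m0') dm; rewrite [leRHS]mulrCA divff ?lt0r_neq0// mulr1.
have l0' : 0 < l0%:R :> R by rewrite ltr0n.
have dl0 : d <= l0%:R^-1.
  apply: (le_trans dm); rewrite -[leRHS]mul1r; apply: ler_pM => //.
  - by case/andP: del01; lra.
  - by rewrite lef_pV2 ?posrE// ler_nat.
have dn : (1 - del) * (1 + d) ^+ (h - c) <= 1.
  apply: le_trans slack; apply: ler_wpM2l => //.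
  apply: (@le_trans _ _ ((1 + l0%:R^-1) ^+ (h - c))).
    by apply: lerXn2r; rewrite ?nnegrE; [lra| |lra]; rewrite addr_ge0// invr_ge0 ltW.
  by apply: ler_weXn2l; [rewrite lerDl invr_ge0 ltW|exact: leq_subr].
have step := ballot_step hc0 t1 d0 m0' del01 md dn.
rewrite -clkE in step.
set X := (if _ then _ else _).
have X0 : 0 <= X by rewrite /X; case: ifP.
have hcE : (h - c).-1 = (h - c.+1)%N by rewrite subnS.
have XV : subsol m.+1 c.+1 <= X.
  rewrite /X; case: ifP => [_|/negbT]; first exact: IH.
  rewrite -ltNge => cb; apply: sub_le; apply: ballot_le0; first lra.
  rewrite ler_pdivrMr ?e_gt0// natrB; last by rewrite -subn_gt0.
  by move: cb; rewrite /barrier mulrC; lra.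
have VV := IH c kL'.
pose W (l c : nat) : R := eta * expR (c%:R - h%:R + (e - 1) * (ln L%:R - ln l%:R)).
have W0 l' c' : 0 <= W l' c' by rewrite mulr_ge0 ?expR_ge0.
have Wstep : (1 - m.+1%:R^-1) * W m.+1 c + m.+1%:R^-1 * W m.+1 c.+1 <= W m c.
  have -> : W m.+1 c.+1 = W m.+1 c * e.
    by rewrite /W -mulrA -expRD; congr (_ * expR _); rewrite -(natr1 c); ring.
  have -> : W m c = W m.+1 c * expR ((e - 1) * (ln m.+1%:R - ln m%:R)).
    by rewrite /W -mulrA -expRD; congr (_ * expR _); ring.
  set V := W m.+1 c.
  have -> : (1 - m.+1%:R^-1) * V + m.+1%:R^-1 * (V * e) = V * (1 + (e - 1) * m.+1%:R^-1) by ring.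
  apply: ler_wpM2l; first exact: W0.
  apply: le_trans (expR_ge1Dx _); rewrite lerD2l; apply: ler_wpM2l.
    by have := e_ge2; lra.
  exact: ln_succ_ge.
have XB : m.+1%:R / L%:R * Num.max 0 (ballot (h - c).-1 (clk m.+1)) - W m.+1 c.+1 <= X.
  rewrite hcE; case: (leP 0 (ballot (h - c.+1) (clk m.+1))) => [_|_]; first exact: XV.
  rewrite mulr0 sub0r; apply: le_trans X0; rewrite oppr_le0; exact: W0.
move: VV XB; rewrite /subsol -/(W m.+1 c) -/(W m c).
set A := ballot (h - c) (clk m.+1) in step *; set B := Num.max _ _ in step *.
set A' := ballot (h - c) (clk m) in step *.
have i0 : 0 <= m.+1%:R^-1 :> R by rewrite invr_ge0.
have i1 : 0 <= 1 - m.+1%:R^-1 :> R by rewrite subr_ge0 invf_le1// ler1n.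
move=> /(ler_wpM2l i1) VV /(ler_wpM2l i0) XB.
apply: (@le_trans _ _ ((1 - m.+1%:R^-1) * (m.+1%:R / L%:R * A - W m.+1 c)
   + m.+1%:R^-1 * (m.+1%:R / L%:R * B - W m.+1 c.+1))); last exact: lerD.
have : (m%:R * A' - m%:R * A) / L%:R <= B / L%:R.
  by apply: ler_wpM2r; [rewrite invr_ge0 ltW|rewrite -mulrBr].
have -> : (1 - m.+1%:R^-1) * (m.+1%:R / L%:R * A - W m.+1 c)
   + m.+1%:R^-1 * (m.+1%:R / L%:R * B - W m.+1 c.+1)
   = m%:R * A / L%:R + B / L%:R
     - ((1 - m.+1%:R^-1) * W m.+1 c + m.+1%:R^-1 * W m.+1 c.+1).
  rewrite -[m.+1%:R]natr1; field.
  by rewrite natr1 !lt0r_neq0.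
move: Wstep; set w := _ + _; set Li := L%:R^-1.
by rewrite mulrBl; lra.
Qed.

End Survival.

End Ballot.

(** * Choice sequences *)

Section WalkLemmas.
Context {R : realType}.
Notation clock := (@clock R).

Lemma clock_cat S x y : clock S (x ++ y) = clock S x + clock (endS S x) y.
Proof.
elim: x S => [|[] x IH] S //=; first by rewrite add0r.
by rewrite IH addrA.
Qed.

Lemma endS_cat S x y : endS S (x ++ y) = endS (endS S x) y.
Proof. by rewrite /endS foldl_cat. Qed.

Lemma endS_le S x : (endS S x <= S + count_mem true x)%N.
Proof.
elim: x S => [|b x IH] S /=; first by rewrite addn0.
apply: leq_trans (IH _) _; case: b => /=; first by rewrite addSnnS.
by rewrite leq_add2r leq_pred.
Qed.

Lemma exists_prefix (m : nat) (x : seq bool) : (m <= count_mem true x)%N ->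
  exists x1 x2, x = x1 ++ x2 /\ count_mem true x1 = m.
Proof.
elim: x m => [|b x IH] m /=; first by rewrite leqn0 => /eqP ->; exists [::], [::].
case: m => [|m] mx; first by exists [::], (b :: x).
case: b mx => mx.
  have [|x1 [x2 [-> c1]]] := IH m; first by move: mx; rewrite add1n.
  by exists (true :: x1), x2; rewrite /= c1.
have [|x1 [x2 [-> c1]]] := IH m.+1; first by [].
by exists (false :: x1), x2; rewrite /= c1.
Qed.

Lemma clock_ge S x :
  ln (S + count_mem true x).+1%:R - ln S.+1%:R <= clock S x.
Proof.
elim: x S => [|[] x IH] S /=; first by rewrite addn0 subrr.
  have := IH S.+1; have := @ln_succ_le R S.+1 isT.
  have -> : (S + (1 + count_mem true x)).+1 = (S.+1 + count_mem true x).+1 by lia.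
  by set a := ln S.+2%:R; set b := ln S.+1%:R; set i := S.+1%:R^-1; set d := ln _; lra.
rewrite add0n; case: S => [|S] /=; first exact: IH.
apply: le_trans (IH _); set m := count_mem true x.
have p (k : nat) : 0 < k.+1%:R :> R by [].
rewrite -!ln_div ?posrE// ler_ln ?posrE ?divr_gt0//.
rewrite ler_pdivrMr// mulrAC ler_pdivlMr// -!natrM ler_nat.
by nia.
Qed.

(** If the walk is small compared with [B * expR (- clock / gam)] after each attachment,
    then there are at most [gam * B] attachments, since each of them is worth the walk
    times the increment of the clock. *)
Lemma exists_high (gam B : R) S x : 0 < gam -> 0 <= B ->
  gam * B < (count_mem true x)%:R ->
  exists y y', x = y ++ true :: y' /\
    B * expR (- (clock S (rcons y true) / gam)) <= (endS S (rcons y true))%:R.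
Proof.
move=> g0; elim: x S B => [|[] x IH] S B B0 /=.
- by move=> H; have := mulr_ge0 (ltW g0) B0; lra.
- move=> H; have s0 : 0 < S.+1%:R :> R by [].
  set z : R := (S.+1%:R^-1 / gam).
  have z0 : 0 < z by rewrite divr_gt0// invr_gt0.
  have [hi|lo] := leP (B * expR (- z)) S.+1%:R.
    by exists [::], x; split => //=; rewrite addr0 -/z.
  have B'0 : 0 <= B * expR (- z) by rewrite mulr_ge0 ?expR_ge0.
  have [|y [y' [-> E]]] := IH S.+1 (B * expR (- z)) B'0.
    have BE : B = B * expR (- z) * expR z by rewrite -mulrA -expRD addNr expR0 mulr1.
    have ez := @expR_ge1Dx R z.
    have h1 : B * expR (- z) * (1 + z) <= B by rewrite {2}BE; apply: ler_wpM2l.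
    have h2 : S.+1%:R * z <= B * expR (- z) * z by apply: ler_wpM2r; exact: ltW.
    have h3 : gam * (S.+1%:R * z) = 1.
      by rewrite /z (mulrA S.+1%:R) divff ?lt0r_neq0// mul1r divff ?lt0r_neq0.
    have := ler_wpM2l (ltW g0) h1; have := ler_wpM2l (ltW g0) h2; rewrite h3.
    move: H; rewrite add1n -natr1 mulrDr mulr1.
    set K := count_mem true x; set b := B * expR (- z) => H H1 H2.
    by move: H1 H2; rewrite !mulrDr; lra.
  exists (true :: y), y'; split => //=; apply: le_trans E.
  by rewrite mulrDl opprD expRD mulrA -/z.
- rewrite add0n => H; have [y [y' [-> E]]] := IH S.-1 B B0 H.
  by exists (false :: y), y'.
Qed.

Lemma live_pos S y y' : live S (y ++ true :: y') -> pos S (rcons y true).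
Proof.
elim: y S => [|b y IH] S /=; first by move=> /andP[->].
by move=> /andP[-> /IH].
Qed.

Lemma live_of_S S x :
  (forall j, (j < size x)%N -> 0 < S%:Z + \sum_(b <- take j x) incr b) -> live S x.
Proof.
elim: x S => [//|b x IH] S H /=.
have S0 : (0 < S)%N by have := H 0%N isT; rewrite take0 big_nil addr0.
rewrite S0 /=; apply: IH => j jx; have := H j.+1 jx; rewrite /= big_cons addrA.
have -> : S%:Z + incr b = (nxt S b)%:Z by rewrite /incr; case: b {H} => /=; lia.
by [].
Qed.

Lemma XX_live n x : XX n x -> live 1 x.
Proof. by move=> Xx; apply: live_of_S => j jx; exact: XX_gt0 Xx j jx. Qed.

Lemma XX_count n x : XX n x -> count_mem true x = n.
Proof. by move=> /and3P[_ /eqP]. Qed.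

End WalkLemmas.

(** * Elementary estimates *)

Section Core.
Context {R : realType}.
Notation e := (expR 1 : R).
Notation clock := (@clock R).

Lemma Pr_Ex (A : Type) (mu : distr R A) (E : pred A) :
  Pr mu E = Ex mu (fun a => (E a)%:R).
Proof.
rewrite /Pr /Ex big_mkcond; apply: eq_bigr => pa _.
by case: (E _); rewrite ?mulr1 ?mulr0.
Qed.

(** The steps after the prefix [X] can only increase the height. *)
Lemma Pr_height_ge (l0 : nat) (bar : nat -> R) (X y : seq bool) (th : R) :
  live 1 (X ++ y) ->
  mean (deco l0 bar 1 X) root0 (fun st => (deep th st)%:R)
  <= Pr (law R (X ++ y)) (fun T => th <= (height T)%:R).
Proof.
move=> lx; pose z2 := [seq (b, @child R None) | b <- y].
pose z := deco l0 bar 1 X ++ z2.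
have walkz : [seq s.1 | s <- z] = X ++ y.
  by rewrite map_cat walk_deco -map_comp map_id.
have zdepth s : List.In s z -> s.1 -> forall a, (s.2 a).1 = a.1.+1.
  have In_cat (z1 : seq (bool * (label -> label))) : List.In s (z1 ++ z2) ->
      List.In s z1 \/ List.In s z2.
    elim: z1 => [|s' z1 IH] /=; first by right.
    by case=> [->|/IH []]; [left; left|left; right|right].
  case/In_cat => [H|]; first exact: deco_depth H.
  rewrite /z2 => H _.
  by elim: y {lx z2 z walkz In_cat} H => //= b y IH [<- //|/IH].
apply: (@le_trans _ _ (mean z root0 (fun st => (deep th st)%:R))).
  by apply: mean_deep_cat; rewrite -/z walkz.
rewrite Pr_Ex -walkz (Ex_law_mean z (fun=> (0%N, Some 0%N))).
apply: (@mean_le_inv R _ depthok).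
- by move=> s st v sz ok vT; apply: depthok_next => //; exact: zdepth sz.
- exact: depthok0.
- by move=> st ok; rewrite ler_nat; case D: (deep th st) => //=; rewrite deep_height.
Qed.

Lemma expRN_le (u : R) : 0 <= u -> expR (- u) <= 1 - u + u ^+ 2.
Proof.
move=> u0; rewrite expRN.
have h := @expR_ge1Dx R u.
apply: (@le_trans _ _ (1 + u)^-1); first by rewrite lef_pV2 ?posrE ?expR_gt0//; lra.
rewrite -div1r ler_pdivrMr; last lra.
have : 0 <= u ^+ 3 by exact: exprn_ge0.
by rewrite !exprS expr0; lra.
Qed.

(** Chernoff bound for the number of non-record edges. *)
Lemma few_edges (l0 : nat) S x (eta t : R) : 0 <= eta -> 0 <= t -> t <= nonrec_clock l0 S x ->
  expR (eta / 2 * ((1 - eta) * t)) * nonrec_laplace l0 (eta / 2) S x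
  <= expR (- (eta ^+ 2 / 4 * t)).
Proof.
move=> eta0 t0 tc.
have th0 : 0 <= eta / 2 by lra.
have /andP[_ H] := @nonrec_laplace_le R l0 (eta / 2) S x th0.
have H1 := expRN_le th0.
have H2 : expR (- (eta / 2)) <= 1 by rewrite expR_le1; lra.
apply: (le_trans (ler_wpM2l (expR_ge0 _) H)); rewrite -expRD ler_expR.
have h3 : 0 <= 1 - expR (- (eta / 2)) by lra.
have := ler_wpM2l h3 tc.
have := ler_wpM2r t0 H1.
set E := expR _; set O := nonrec_clock _ _ _.
by rewrite !expr2; lra.
Qed.

Lemma natr_le_expR (n : nat) : n%:R <= expR n%:R :> R.
Proof. by apply: le_trans (expR_ge1Dx _); rewrite lerDr. Qed.

Lemma pow_le_fact_expR (u : R) (n : nat) : 0 <= u -> u ^+ n <= n`!%:R * expR u.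
Proof.
move=> u0; case: n => [|n].
  by rewrite expr0 fact0 mul1r -expR0 ler_expR.
rewrite -ler_pdivrMl ?ltr0n ?fact_gt0// mulrC.
by apply: le_trans (expR_ge1Dxn n u0); rewrite lerDr.
Qed.

Lemma ballot1_le1 (n : nat) : ballot n (1 : R) <= 1.
Proof.
have f0 : 0 < n`!%:R :> R by rewrite ltr0n fact_gt0.
rewrite /ballot expr1n mulr1 ler_pdivrMr// mul1r.
apply: (@le_trans _ _ n%:R); last first.
  by rewrite ler_nat; case: n {f0} => // n; rewrite factS leq_pmulr// fact_gt0.
have := @e_ge2 R => e2.
have : n%:R / e <= n%:R :> R by rewrite ler_pdivrMr ?expR_gt0// ler_peMr//; lra.
lra.
Qed.

(** With [22], the factor [expR (- 21 * n)] is smaller than the powers of [lam] in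
    [survive_start] as soon as [n] exceeds [ln lam / 10]. *)
Lemma ballot1_far (n : nat) : ballot n (1 : R) <= expR (expR 22 - 21 * n%:R).
Proof.
have f0 : 0 < n`!%:R :> R by rewrite ltr0n fact_gt0.
rewrite /ballot expr1n mulr1 ler_pdivrMr//.
apply: (@le_trans _ _ n%:R).
  have := @e_ge2 R => e2.
  have : n%:R / e <= n%:R :> R by rewrite ler_pdivrMr ?expR_gt0// ler_peMr//; lra.
  lra.
apply: (le_trans (natr_le_expR n)).
have := @pow_le_fact_expR (expR 22) n (expR_ge0 _).
rewrite -expRM_natr => H.
have -> : expR n%:R = expR (22 * n%:R) * expR (- (21 * n%:R)) :> R.
  by rewrite -expRD; congr expR; ring.
apply: (le_trans (ler_wpM2r (expR_ge0 _) H)).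
rewrite le_eqVlt; apply/orP; left; apply/eqP.
by rewrite expRD; ring.
Qed.

Lemma e_le275 : e <= 11 / 4.
Proof.
have /expRN_pade h : 0 <= 4^-1 :> R by rewrite invr_ge0.
have E : expR (- 1) = expR (- 4^-1) ^+ 4 :> R.
  by rewrite -expRM_natr; congr expR; lra.
have h1 : 7 / 9 <= expR (- 4^-1) :> R by lra.
have h2 : 4 / 11 <= expR (- 1) :> R.
  rewrite E; apply: le_trans (_ : (7 / 9) ^+ 4 <= _).
    by rewrite !exprS expr0; lra.
  by apply: lerXn2r; rewrite ?nnegrE ?expR_ge0//; lra.
have e0 := expR_gt0 (1 : R).
have := ler_wpM2r (ltW e0) h2; rewrite expRN mulVf ?lt0r_neq0//; lra.
Qed.

End Core.

(** * Tuning of the parameters *)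

Section Tuning.
Context {R : realType}.
Notation e := (expR 1 : R).

(** Here [lam] stands for [ln n] and [om] for [ln (ln n)]; [l0] is about [lam ^ A]. *)
Section Start.
Variables (L l0 : nat) (A om lam : R).
Hypothesis lamE : lam = expR om.
Hypothesis A27 : 27 / 10 <= A.
Hypothesis om_large : 2 * (17 + expR 22) <= om.
Hypothesis l0_ge : expR (A * om) <= l0%:R.
Hypothesis l0L : (l0 < L)%N.
Hypothesis lnL : ln L%:R <= lam + 1.

(** Larger than [target / l0], for [target_slack]. *)
Definition discr : R := 5 * expR ((1 - A) * om).
(** Above the zero [e * clk L discr l0] of [ballot], by a bounded amount. *)
Definition target : nat := (Num.trunc (e * (clk L discr l0 + 1))).+1.
Definition shortfall : nat := Num.trunc (om / 10).

Let om40 : 40 <= om.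
Proof. by apply: le_trans om_large; have := @expR_ge1Dx R 22; lra. Qed.

Let lam40 : 40 <= lam.
Proof. by rewrite lamE; apply: le_trans (expR_ge1Dx _); have := om40; lra. Qed.

Let l00 : (0 < l0)%N.
Proof. by rewrite -(ltr0n R); apply: lt_le_trans l0_ge; exact: expR_gt0. Qed.

Let D := ln L%:R - ln l0%:R : R.

Let D0 : 0 <= D.
Proof. by rewrite subr_ge0; apply: ler_ln_nat => //; exact: ltnW. Qed.

Let D_le : D <= lam + 1.
Proof.
have : 0 <= ln l0%:R :> R by apply: ln_ge0; rewrite ler1n.
by rewrite /D; move: lnL; set a := ln L%:R; set b := ln l0%:R; lra.
Qed.

Let discr0 : 0 <= discr. Proof. by rewrite mulr_ge0 ?expR_ge0. Qed.

Let discr_lam : discr * (lam + 1) <= 1.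
Proof.
have h1 : (1 - A) * om <= - (17 / 10 * om).
  by rewrite -mulNr; apply: ler_wpM2r; move: om40 A27; lra.
have h2 : expR ((1 - A) * om) <= expR (- (17 / 10 * om)) by rewrite ler_expR.
have h3 : 10 <= expR (7 / 10 * om).
  by apply: le_trans (expR_ge1Dx _); move: om40; lra.
have h4 : lam + 1 <= 2 * lam by move: lam40; lra.
apply: (@le_trans _ _ (5 * expR (- (17 / 10 * om)) * (2 * lam))).
  apply: ler_pM => //; first by move: lam40; lra.
  by apply: ler_wpM2l.
have -> : 5 * expR (- (17 / 10 * om)) * (2 * lam) = 10 * (expR (7 / 10 * om))^-1.
  rewrite lamE -expRN.
  have -> : - (17 / 10 * om) = - (7 / 10 * om) + - om by field.
  by rewrite [in LHS]expRD [expR (- om)]expRN; field; rewrite gt_eqF ?expR_gt0.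
by rewrite ler_pdivrMr ?expR_gt0// mul1r.
Qed.

Lemma discr_lt1 : 0 <= discr < 1.
Proof.
rewrite discr0 /=; have h := discr_lam.
have h2 : discr * 2 <= discr * (lam + 1) by apply: ler_wpM2l => //; move: lam40; lra.
by move: h2 discr0; lra.
Qed.

Lemma discr_ln : discr * (ln L%:R - ln l0%:R) <= 1.
Proof. by apply: le_trans discr_lam; apply: ler_wpM2l. Qed.

Let S := clk L discr l0.

Let S1 : 1 <= S.
Proof. by apply: clk_ge1; [exact: discr_lt1|rewrite l00 ltnW]. Qed.

Let S_le : S <= lam + 2.
Proof.
have /andP[d0 d1] := discr_lt1.
have h : (1 - discr) * D <= D.
  by rewrite -[leRHS]mul1r; apply: ler_wpM2r => //; move: d0; lra.
by rewrite /S /clk -/D; move: h D_le; lra.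
Qed.

Lemma target_ge : e * (clk L discr l0 + 1) <= target%:R.
Proof. by apply: ltW; exact: truncnS_gt. Qed.

Lemma target_le : target%:R <= e * clk L discr l0 + 4.
Proof.
rewrite /target -natr1.
have e0 := expR_gt0 (1 : R).
have h : (Num.trunc (e * (clk L discr l0 + 1)))%:R <= e * (clk L discr l0 + 1).
  by rewrite truncn_le mulr_ge0 ?ltW//; have := S1; rewrite /S; lra.
by have := @e_le275 R; move: h; rewrite mulrDr mulr1; lra.
Qed.

Let h4 : target%:R <= 4 * lam.
Proof.
apply: (le_trans target_le).
have : e * clk L discr l0 <= 11 / 4 * (lam + 2).
  apply: ler_pM; [exact: expR_ge0| |exact: e_le275|exact: S_le].
  by have := S1; rewrite /S; lra.
by move: lam40; lra.
Qed.

Lemma target_slack : (1 - discr) * (1 + l0%:R^-1) ^+ target <= 1.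
Proof.
have l0' : 0 < l0%:R :> R by rewrite ltr0n.
have i0 : 0 <= l0%:R^-1 :> R by rewrite invr_ge0 ltW.
have hl : target%:R * l0%:R^-1 <= discr.
  rewrite -/(target%:R / l0%:R) ler_pdivrMr//.
  apply: (le_trans h4); apply: (@le_trans _ _ (discr * expR (A * om))); last first.
    by apply: ler_wpM2l.
  rewrite /discr -mulrA -expRD.
  have -> : (1 - A) * om + A * om = om by ring.
  by rewrite -lamE; move: lam40; lra.
have h1 : (1 + l0%:R^-1) ^+ target <= expR discr.
  apply: (@le_trans _ _ (expR (l0%:R^-1) ^+ target)).
    by apply: lerXn2r; rewrite ?nnegrE ?expR_ge0 ?addr_ge0 ?expR_ge1Dx.
  by rewrite -expRM_natl ler_expR.
have h2 : 1 - discr <= expR (- discr) by exact: expR_ge1Dx.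
have /andP[d0 d1] := discr_lt1.
apply: (@le_trans _ _ (expR (- discr) * expR discr)).
  by apply: ler_pM => //; rewrite subr_ge0 ltW.
by rewrite -expRD addNr expR0.
Qed.

Let eta_ : R := expR (- 17 - 3 / 2 * om).

Let far n : (shortfall < n)%N -> ballot n (1 : R) <= eta_ * expR (- n%:R).
Proof.
move=> nmn; apply: (le_trans (ballot1_far n)).
rewrite /eta_ -expRD ler_expR.
have : om / 10 < n%:R.
  apply: lt_le_trans (truncnS_gt _) _; rewrite ler_nat; exact: nmn.
by move: om_large; set E := expR 22; lra.
Qed.

(** A lineage survives with probability [l0 / L], up to the power [3 / 2] of [lam] which it
    costs a bridge to stay below a line. *)
Lemma survive_start :
  l0%:R / L%:R * expR (- 17 - 3 / 2 * om)
  <= survive l0 (barrier L target discr) L (fun c => (closeby target shortfall c)%:R) (L - l0) 0.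
Proof.
have L0 : 0 < L%:R :> R by rewrite ltr0n; apply: leq_trans l0L.
have l0' : 0 < l0%:R :> R by rewrite ltr0n.
have eta0 : 0 <= eta_ by exact: expR_ge0.
have close n : (n <= shortfall)%N -> ballot n (1 : R) <= 1 by move=> _; exact: ballot1_le1.
apply: le_trans (subsol_le_survive l00 l0L discr_lt1 target_slack eta0 close far 0 (leqnn _)).
rewrite subKn; last exact: ltnW.
rewrite /subsol subn0 -/S -/D sub0r.
have e2 := @e_ge2 R; have e3 := @e_le275 R.
have e0 : 0 < e by exact: expR_gt0.
have hge : e * (S + 1) <= target%:R by exact: target_ge.
have hle : target%:R <= e * S + 4 by exact: target_le.
have B : expR (- 16 - 3 / 2 * om) <= ballot target S.
  apply: le_trans (ballot_ge S1 _ hle); last first.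
    rewrite lerBrDr ler_pdivlMr//; by move: hge; rewrite mulrC addrC.
  rewrite ler_expR.
  have s0 : 0 < S by move: S1; lra.
  have h0 : 0 < target%:R :> R by [].
  have lnS : ln S <= om + 1.
    rewrite -[leRHS]expRK ler_ln ?posrE ?expR_gt0// expRD -lamE.
    apply: (le_trans S_le); apply: (@le_trans _ _ (lam * 2)); first by move: lam40; lra.
    by apply: ler_wpM2l => //; move: lam40; lra.
  have lnh : ln target%:R <= om + 2.
    rewrite -[leRHS]expRK ler_ln ?posrE ?expR_gt0// expRD -lamE.
    apply: (le_trans h4); rewrite mulrC; apply: ler_wpM2l; first by move: lam40; lra.
    have -> : 2 = 1 + 1 :> R by [].
    rewrite expRD; apply: (@le_trans _ _ (2 * 2)); first by lra.
    by apply: ler_pM.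
  by move: lnS lnh; set a := ln S; set b := ln target%:R; lra.
have W : expR (- target%:R + (e - 1) * D) <= l0%:R / L%:R.
  rewrite -[leRHS]lnK ?posrE ?divr_gt0// ler_expR ln_div ?posrE//.
  have -> : ln l0%:R - ln L%:R = - D by rewrite /D opprB.
  suff : e * D <= target%:R by rewrite mulrBl mul1r; lra.
  apply: le_trans hge; apply: ler_wpM2l; first exact: ltW.
  have := discr_ln; rewrite -/D /S /clk -/D mulrBl mul1r; lra.
have q0 : 0 < l0%:R / L%:R :> R by exact: divr_gt0.
apply: (@le_trans _ _ (l0%:R / L%:R * expR (- 16 - 3 / 2 * om) - eta_ * (l0%:R / L%:R))); last first.
  by apply: lerD; [apply: ler_wpM2l => //; exact: ltW|rewrite lerN2; exact: ler_wpM2l].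
rewrite [eta_ * _]mulrC -mulrBr; apply: ler_wpM2l; first exact: ltW.
rewrite /eta_; have -> : - 16 - 3 / 2 * om = 1 + (- 17 - 3 / 2 * om) by ring.
rewrite [in leRHS]expRD; set E := expR (_ - _).
have E0 : 0 <= E by exact: expR_ge0.
by have := ler_wpM2r E0 e2; lra.
Qed.

Lemma barrier0 : 0 <= barrier L target discr l0.
Proof.
have e0 := expR_gt0 (1 : R).
by rewrite /barrier; have := target_ge; rewrite mulrDr mulr1; lra.
Qed.

Lemma target_shortfall_ge : e * (ln L%:R - ln l0%:R) - om / 10 <= target%:R - shortfall%:R.
Proof.
have nm1 : shortfall%:R <= om / 10 :> R by rewrite truncn_le; move: om40; lra.
have e0 := expR_gt0 (1 : R).
suff : e * D <= target%:R by move: nm1; rewrite -/D; lra.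
apply: le_trans target_ge; apply: ler_wpM2l; first exact: ltW.
have := discr_ln; rewrite -/D /clk -/D mulrBl mul1r; lra.
Qed.

Lemma expR_shortfall_le : expR shortfall%:R <= expR (om / 10).
Proof. by rewrite ler_expR truncn_le; move: om40; lra. Qed.

End Start.

End Tuning.

(** * Height with high probability *)

Section Main.
Context {R : realType}.
Notation e := (expR 1 : R).
Notation clock := (@clock R).

Lemma ln2_le1 : ln 2 <= 1 :> R.
Proof.
have -> : 2 = 1 + 1 :> R by [].
by apply: le_ln1Dx; lra.
Qed.

(** The first half of the attachments already takes the clock to [ln n], up to a constant,
    and [exists_high] is applied to the second half, with the clock [T2]. *)
Lemma exists_good_prefix n x : (0 < n)%N -> XX n x ->
  exists X y (T2 : R),
  [/\ x = X ++ y, pos 1 X, 0 <= T2, ln n%:R - 2 + T2 <= clock 1 X &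
      ln n%:R - ln 25 - T2 / 12 <= ln (endS 1 X)%:R :> R /\
      ln (endS 1 X)%:R <= ln n%:R + 1 :> R].
Proof.
move=> n0 Xx; have cx := XX_count Xx; have lx := XX_live Xx.
have half : (n./2 <= count_mem true x)%N by rewrite cx; lia.
have [x1 [x2 [xE c1]]] := exists_prefix half.
have n0' : 0 < n%:R :> R by rewrite ltr0n.
have c2 : (n <= (count_mem true x2).*2)%N.
  by move: cx; rewrite xE count_cat c1; clear; lia.
have B0 : 0 <= n%:R / 25 :> R by exact: divr_ge0.
have [||y [y' [x2E hi]]] := @exists_high R 12 (n%:R / 25) (endS 1 x1) x2 _ B0.
- by [].
- have : n%:R <= 2 * (count_mem true x2)%:R :> R by rewrite -natrM ler_nat mul2n.
  by move: n0'; lra.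
set T2 := clock _ _ in hi.
have T20 : 0 <= T2 by exact: clock_ge0.
set X := x1 ++ rcons y true.
have XE : x = X ++ y' by rewrite xE x2E /X -cats1 -!catA.
have pX : pos 1 X.
  by move: lx; rewrite xE x2E catA => /live_pos; rewrite /X rcons_cat.
have L0 : 0 < (endS 1 X)%:R :> R.
  by rewrite ltr0n /X -cats1 catA endS_cat.
exists X, y', T2; split => //.
  rewrite /X clock_cat -/T2 lerD2r.
  have := @clock_ge R 1 x1; rewrite c1.
  have : ln n%:R <= ln (1 + n./2).+1%:R + ln 2 :> R.
    rewrite -lnM ?posrE// ler_ln ?posrE ?mulr_gt0// -natrM ler_nat.
    by have := odd_double_half n; lia.
  by have := ln2_le1; set a := ln _; set b := ln _; set c := ln _; lra.
split.
  have -> : ln n%:R - ln 25 - T2 / 12 = ln (n%:R / 25 * expR (- (T2 / 12))) :> R.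
    by rewrite lnM ?posrE ?expR_gt0 ?divr_gt0// expRK ln_div ?posrE//.
  rewrite ler_ln ?posrE ?mulr_gt0 ?expR_gt0//.
  by move: hi; rewrite /X endS_cat.
have eX : (endS 1 X <= n.+1)%N.
  apply: leq_trans (endS_le _ _) _; rewrite add1n ltnS -cx XE.
  by rewrite [leqRHS](count_cat (pred1 true) X y') leq_addr.
apply: (@le_trans _ _ (ln n.+1%:R)); first by apply: ler_ln_nat => //; rewrite -(ltr0n R).
have := @ln_succ_le R n n0; have : n%:R^-1 <= 1 :> R by rewrite invf_le1// ler1n.
by set i := n%:R^-1; set a := ln n.+1%:R; lra.
Qed.

Lemma mean_deep_mono (z : seq (bool * (label -> label))) (st : labelled) (th th' : R) : th <= th' ->
  mean z st (fun st => (deep th' st)%:R) <= mean z st (fun st => (deep th st)%:R) :> R.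
Proof.
move=> le; apply: mean_le => st'; rewrite ler_nat.
case D: (deep th' st') => //=; rewrite lt0b.
by move: D; apply: sub_has => v; apply: le_trans.
Qed.

(** If [l0] is the final level then there is no record, and all edges are counted. *)
Lemma mean_deep_long_clock X (T : R) : pos 1 X -> 0 <= T -> T <= clock 1 X ->
  1 - expR (- (T / 16))
  <= mean (deco (endS 1 X) (fun=> 0 : R) 1 X) root0 (fun st => (deep (T / 2) st)%:R).
Proof.
move=> pX T0 TX.
have t0 : 0 <= 2^-1 / 2 :> R by lra.
have := @mean_deep_typical R (endS 1 X) (fun=> 0 : R) predT X (2^-1 / 2) ((1 - 2^-1) * T)
   pX (fun=> isT) (leqnn _) t0.
have -> : (1 - 2^-1) * T = T / 2 by field.
apply: le_trans; rewrite lerD2l lerN2.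
have L0 : (0 < endS 1 X)%N by apply: leq_trans (lev_le_endS _ _); exact: lev_gt0.
have oc : T <= nonrec_clock (endS 1 X) 1 X.
  apply: (le_trans TX); have := @nonrec_clock_ge R (endS 1 X) 1 X pX.
  rewrite L0 leqnn /= => /(_ isT).
  by have /maxn_idPl -> := lev_le_endS 1 X; rewrite subrr subr0.
have eta0 : 0 <= 2^-1 :> R by lra.
have := few_edges eta0 T0 oc.
have -> : (1 - 2^-1) * T = T / 2 by field.
by have -> : 2^-1 ^+ 2 / 4 * T = T / 16 by field.
Qed.

Lemma nat_above_expR (t : R) : 0 <= t ->
  exists m : nat, (0 < m)%N /\ expR t <= m%:R /\ ln m%:R <= t + 1 :> R.
Proof.
move=> t0; exists (Num.trunc (expR t)).+1.
have e1 := @expR_ge1Dx R t.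
have tr : (Num.trunc (expR t))%:R <= expR t by rewrite truncn_le expR_ge0.
split => //; split; first by apply: ltW; exact: truncnS_gt.
rewrite -[leRHS]expRK ler_ln ?posrE ?expR_gt0//.
rewrite -natr1 expRD; have := @e_ge2 R.
have := ler_wpM2l (expR_ge0 t) (@e_ge2 R); lra.
Qed.

Lemma expR_ge_linear (A om : R) : 0 <= om -> 4 * A + 32 <= om ->
  2 * (A * om) + 16 * om <= expR om.
Proof.
move=> om0 h; apply: le_trans (expR_ge1Dxn 1 om0); rewrite (_ : 2`! = 2%N)//.
have : (4 * A + 32) * om <= om ^+ 2 by rewrite expr2; exact: ler_wpM2r.
by set u := om ^+ 2; rewrite mulrDl; lra.
Qed.

(** The loss [e / 12 * T2] due to the size of [L] is compensated by the non-record edges,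
    which are at least [(1 - eta) * T2], and the loss of the levels below [l0], where no
    record edge is counted, is only [e - 1 + eta] times [ln l0] for the same reason. *)
Lemma height_arith (A eta om lam T2 lL ll hn : R) :
  0 <= eta <= 2^-1 -> 2500 <= om -> 0 <= T2 ->
  lam - 4 - T2 / 12 <= lL -> ll <= A * om + 1 -> e * (lL - ll) - om / 10 <= hn ->
  e * lam - ((e - 1 + eta) * A + 11 / 100) * om <= (1 - eta) * (T2 + A * om - 3) + hn.
Proof.
move=> /andP[eta0 eta1] om2 T20 lLge llle hnge.
have e0 : 0 <= e by exact: expR_ge0.
have e3 := @e_le275 R.
have h1 : e * (lam - 4 - T2 / 12 - (A * om + 1)) <= e * (lL - ll).
  by apply: ler_wpM2l => //; lra.
have h2 : 0 <= T2 * (1 - eta - e / 12) by apply: mulr_ge0 => //; lra.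
by move: h1 h2; rewrite !mulrDr !mulrDl; lra.
Qed.

Lemma error_few (eta t u : R) : 0 <= eta <= 2^-1 -> u - 3 <= t ->
  2 * expR (- (eta ^+ 2 / 4 * t)) <= 3 * expR (- (eta ^+ 2 / 4 * u)).
Proof.
move=> /andP[eta0 eta1] ut.
have e2 : eta ^+ 2 / 4 <= 1 / 16.
  have : eta ^+ 2 <= 2^-1 ^+ 2 by apply: lerXn2r; rewrite ?nnegrE// invr_ge0.
  by rewrite !expr2; lra.
have e20 : 0 <= eta ^+ 2 / 4 by rewrite divr_ge0// exprn_ge0.
set c := eta ^+ 2 / 4 in e2 e20 *.
have h : expR (- (c * t)) <= expR (3 / 16) * expR (- (c * u)).
  rewrite -expRD ler_expR; have := ler_wpM2l e20 ut; rewrite mulrBr; lra.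
have h2 : expR (3 / 16) <= 3 / 2 :> R.
  have : 13 / 16 <= expR (- (3 / 16)) :> R by apply: le_trans (expR_ge1Dx _); lra.
  have x0 := expR_gt0 (3 / 16 : R).
  move=> /(ler_wpM2r (ltW x0)); rewrite expRN mulVf ?lt0r_neq0//; lra.
have := ler_wpM2r (expR_ge0 (- (c * u))) h2; move: h; lra.
Qed.

Lemma error_merge (A om lam C p : R) (L l0 nm : nat) :
  lam = expR om -> 0 <= om -> (0 < L)%N -> (0 < l0)%N -> expR (A * om) <= l0%:R ->
  expR nm%:R <= expR (om / 10) -> 0 <= C <= 6 * lam ->
  l0%:R / L%:R * expR (- 17 - 3 / 2 * om) <= p ->
  8 * (expR nm%:R / L%:R) * C / p + (L%:R * p)^-1 <= expR (23 + (26 / 10 - A) * om).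
Proof.
move=> lamE om0 L0 l00 l0ge nmle /andP[C0 C6] pE.
have L0' : 0 < L%:R :> R by rewrite ltr0n.
have l0' : 0 < l0%:R :> R by rewrite ltr0n.
set E := expR (- 17 - 3 / 2 * om) in pE.
have E0 : 0 < E by exact: expR_gt0.
have q0 : 0 < l0%:R / L%:R * E by rewrite mulr_gt0 ?divr_gt0.
have p0 : 0 < p by exact: lt_le_trans pE.
have pi : p^-1 <= L%:R / (l0%:R * E).
  have -> : L%:R / (l0%:R * E) = (l0%:R / L%:R * E)^-1.
    by field; rewrite !lt0r_neq0.
  by rewrite lef_pV2 ?posrE.
have li : (l0%:R * E)^-1 <= expR (17 + 3 / 2 * om - A * om).
  have -> : 17 + 3 / 2 * om - A * om = - (A * om + (- 17 - 3 / 2 * om)) by ring.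
  rewrite [expR (- (_ + _))]expRN [expR (A * om + _)]expRD -/E.
  rewrite lef_pV2 ?posrE ?mulr_gt0 ?expR_gt0//.
  by apply: ler_wpM2r => //; exact: ltW.
have li0 : 0 <= (l0%:R * E)^-1 by rewrite invr_ge0 mulr_ge0 ?ltW.
have pL : L%:R^-1 * p^-1 <= (l0%:R * E)^-1.
  rewrite -(ler_pM2l L0') mulrA divff ?lt0r_neq0// mul1r; exact: pi.
have pL0 : 0 <= L%:R^-1 * p^-1 by rewrite mulr_ge0// invr_ge0 ltW.
rewrite invfM.
have -> : 8 * (expR nm%:R / L%:R) * C / p = 8 * expR nm%:R * C * (L%:R^-1 * p^-1) by ring.
have h1 : 8 * expR nm%:R * C <= 48 * expR (11 / 10 * om).
  have -> : 48 * expR (11 / 10 * om) = 8 * expR (om / 10) * (6 * lam).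
    rewrite lamE; have -> : 11 / 10 * om = om / 10 + om by field.
    by rewrite expRD; ring.
  by apply: ler_pM => //; exact: ler_wpM2l.
have h10 : 0 <= 8 * expR nm%:R * C by rewrite !mulr_ge0 ?expR_ge0.
have e11 : 1 <= expR (11 / 10 * om).
  by apply: le_trans (expR_ge1Dx _); rewrite lerDl mulr_ge0.
apply: (@le_trans _ _ (49 * expR (11 / 10 * om) * (l0%:R * E)^-1)).
  have := ler_pM h10 pL0 h1 pL; have := ler_wpM2r li0 e11; move: pL.
  by set a := L%:R^-1 * _; set b := (_ * E)^-1; lra.
have -> : 23 + (26 / 10 - A) * om = 6 + (11 / 10 * om + (17 + 3 / 2 * om - A * om)) by field.
rewrite expRD [expR (11 / 10 * om + _)]expRD mulrA; apply: ler_pM => //.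
apply: ler_wpM2r; first exact: expR_ge0.
have -> : 6 = 1 * 6%:R :> R by rewrite mul1r.
rewrite expRM_natr; apply: (@le_trans _ _ (2 ^+ 6)).
  by rewrite !exprS expr0; lra.
by apply: lerXn2r; rewrite ?nnegrE ?expR_ge0 ?e_ge2.
Qed.

Lemma mean_deep_short_clock X (A eta om lam T2 : R) :
  pos 1 X -> lam = expR om -> 27 / 10 <= A -> 0 < eta <= 2^-1 ->
  2 * (17 + expR 22) <= om -> 2500 <= om -> 4 * A + 32 <= om ->
  clock 1 X <= 6 * lam -> 0 <= T2 -> lam - 2 + T2 <= clock 1 X ->
  lam - 4 - T2 / 12 <= ln (endS 1 X)%:R -> ln (endS 1 X)%:R <= lam + 1 ->
  exists l0 (bar : nat -> R),
  1 - 3 * expR (- (eta ^+ 2 / 4 * (A * om))) - expR (23 + (26 / 10 - A) * om)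
  <= mean (deco l0 bar 1 X) root0
       (fun st => (deep (e * lam - ((e - 1 + eta) * A + 11 / 100) * om) st)%:R).
Proof.
move=> pX lamE A27 /andP[eta0 eta1] om1 om2 om3 cX T20 cT lnLge lnLle.
set L := endS 1 X in lnLge lnLle *.
have om0 : 0 <= om by lra.
have Aom0 : 0 <= A * om by apply: mulr_ge0; lra.
have [l0 [l00 [l0ge l0le]]] := nat_above_expR Aom0.
have L0 : (0 < L)%N by apply: leq_trans (lev_le_endS _ _); exact: lev_gt0.
have L0' : 0 < L%:R :> R by rewrite ltr0n.
have l0' : 0 < l0%:R :> R by rewrite ltr0n.
have lam_om : 2 * (A * om) + 30 <= lam.
  by rewrite lamE; apply: le_trans (expR_ge_linear om0 om3); lra.
have l0L : (l0 < L)%N.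
  have : ln l0%:R < ln L%:R :> R by move: l0le lnLge cX cT lam_om Aom0; lra.
  by rewrite ltr_ln ?posrE// ltr_nat.
have lnl0 : A * om <= ln l0%:R by rewrite -[leLHS]expRK ler_ln ?posrE ?expR_gt0.
have dL := discr_lt1 lamE A27 om1.
have dD := discr_ln lamE A27 om1 l0ge lnLle.
pose del := discr A om; pose h := target L l0 A om; pose nm := shortfall om.
pose bar := barrier L h del.
exists l0, bar.
have psurv := survive_start lamE A27 om1 l0ge l0L lnLle.
set good := closeby h nm.
pose p := survive l0 bar L (fun c => (good c)%:R) (L - l0) 0.
have pE : l0%:R / L%:R * expR (- 17 - 3 / 2 * om) <= p.
  by exact: psurv.
have q0 : 0 < l0%:R / L%:R * expR (- 17 - 3 / 2 * om) by rewrite mulr_gt0 ?expR_gt0 ?divr_gt0.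
have p0 : 0 < p by exact: lt_le_trans pE.
pose t := T2 + A * om - 3.
have t0 : 0 <= t.
  have : 3 <= A * om.
    by apply: (@le_trans _ _ (27 / 10 * om)); [lra|apply: ler_wpM2r].
  by rewrite /t; lra.
have tc : t <= nonrec_clock l0 1 X.
  have := @nonrec_clock_ge R l0 1 X pX; rewrite l00 ltnW// => /(_ isT).
  have -> : maxn l0 (lev 1 X) = l0.
    by apply/maxn_idPl; exact: leq_trans (lev_le _ _) l00.
  by rewrite -/L; set oc := nonrec_clock _ _ _; move: cT lnLle lnl0; rewrite /t; lra.
have eta2 : 0 <= eta / 2 by lra.
have gh c : good c -> h%:R - nm%:R <= c%:R :> R.
  by rewrite /good /closeby => hc; rewrite lerBlDr -natrD ler_nat.
have bmono (l l' : nat) : (l <= l')%N -> bar l <= bar l' by exact: barrier_mono.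
pose w : R := expR nm%:R / L%:R.
have w0 : 0 <= w by rewrite divr_ge0 ?expR_ge0.
have bar0 : 0 <= bar l0 by exact: barrier0.
have Hw (l c : nat) : (l0 <= l <= L)%N -> c%:R <= bar l ->
    survive l0 bar L (fun c => (good c)%:R) (L - l) c <= w * l%:R.
  by move=> lL cb; apply: survive_le.
have := @mean_deep_second R l0 bar good X (eta / 2) ((1 - eta) * t) (h%:R - nm%:R) w
   pX _ eta2 gh bmono w0 bar0 Hw p0.
rewrite l00 -/L l0L => /(_ isT) H.
have eta01 : 0 <= eta <= 2^-1 by rewrite ltW.
have hnm := target_shortfall_ge lamE A27 om1 l0ge lnLle.
apply: le_trans (mean_deep_mono _ _ (height_arith eta01 om2 T20 lnLge l0le hnm)).
apply: le_trans H; rewrite -/p; apply: lerB.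
  apply: lerB => //.
  apply: le_trans (error_few eta01 (_ : A * om - 3 <= t)); last by rewrite /t lerD2r lerDr.
  by apply: ler_wpM2l => //; apply: few_edges => //; exact: ltW.
apply: (error_merge lamE om0 L0 l00 l0ge) => //; first exact: expR_shortfall_le om1.
by rewrite clock_ge0.
Qed.

End Main.

Section Assembly.
Context {R : realType}.
Notation e := (expR 1 : R).

Lemma ln25_le4 : ln 25 <= 4 :> R.
Proof.
have E : expR 4 = expR 2^-1 ^+ 8 :> R.
  by rewrite -expRM_natr; congr expR; lra.
rewrite -[leRHS]expRK ler_ln ?posrE ?expR_gt0// E.
apply: (@le_trans _ _ ((3 / 2) ^+ 8)); first by rewrite !exprS expr0; lra.
have h := @expR_ge1Dx R 2^-1.
by apply: lerXn2r; rewrite ?nnegrE ?expR_ge0//; lra.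
Qed.

Lemma natr_eq_expR_expR (n : nat) (om := ln (ln n%:R) : R) : 0 < om ->
  [/\ (0 < n)%N, 0 < ln n%:R :> R & ln n%:R = expR om].
Proof.
move=> om0.
have l0 : 0 < ln n%:R :> R.
  by rewrite ltNge; apply/negP => /ln0 l0; move: om0; rewrite /om l0 ltxx.
split => //; last by rewrite lnK.
by rewrite lt0n; apply/eqP => n0; move: l0; rewrite n0 ln0// ltxx.
Qed.

(** The parameter [A] trades the height against the probability of failure. *)
Theorem Pr_height (A eta : R) : 27 / 10 <= A -> 0 < eta <= 2^-1 ->
  exists om0 : R, 0 < om0 /\ forall n x (om := ln (ln n%:R) : R),
  om0 <= om -> XX n x ->
  1 - 3 * expR (- (eta ^+ 2 / 4 * (A * om))) - expR (23 + (26 / 10 - A) * om)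
  <= Pr (law R x) (fun T => e * ln n%:R - ((e - 1 + eta) * A + 11 / 100) * om
                            <= (height T)%:R).
Proof.
move=> A27 eta01.
pose om0 : R := 2 * (17 + expR 22) + 2500 + (4 * A + 32).
have E22 := expR_gt0 (22 : R).
exists om0; split; first by rewrite /om0; lra.
move=> n x om omge Xx.
have om1 : 2 * (17 + expR 22) <= om by move: omge; rewrite /om0; lra.
have om2 : 2500 <= om by move: omge; rewrite /om0; lra.
have om3 : 4 * A + 32 <= om by move: omge; rewrite /om0; lra.
have ompos : 0 < om by lra.
have [n0 lam0 lamE] := natr_eq_expR_expR ompos.
set lam := ln n%:R in lam0 lamE *; rewrite -/om in lamE.
have [X [y [T2 [xE pX T20 cT [lnLge lnLle]]]]] := @exists_good_prefix R _ _ n0 Xx.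
have lx : live 1 (X ++ y) by rewrite -xE; exact: XX_live Xx.
rewrite -/lam in cT lnLge lnLle.
rewrite xE.
have [cX|/ltW cX] := leP (clock 1 X) (6 * lam).
  have lnLge' : lam - 4 - T2 / 12 <= ln (endS 1 X)%:R.
    by apply: le_trans lnLge; rewrite lerD2r lerD2l lerN2 ln25_le4.
  have [l0 [bar H]] := mean_deep_short_clock pX lamE A27 eta01 om1 om2 om3 cX T20 cT lnLge' lnLle.
  exact: le_trans H (Pr_height_ge _ _ _ lx).
have lam60 : 0 <= 6 * lam by lra.
case/andP: eta01 => eta0 eta1.
have Aom0 : 0 <= A * om by apply: mulr_ge0; lra.
set th := e * lam - _.
apply: (le_trans _ (Pr_height_ge (endS 1 X) (fun=> 0 : R) th lx)).
have thle : th <= 6 * lam / 2.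
  have h1 : e * lam <= 11 / 4 * lam by apply: ler_wpM2r; [exact: ltW|exact: e_le275].
  have h2 : 0 <= ((e - 1 + eta) * A + 11 / 100) * om.
    apply: mulr_ge0; last exact: ltW.
    apply: addr_ge0 => //; apply: mulr_ge0; last by lra.
    by have := @e_ge2 R; lra.
  by rewrite /th; move: h1 h2 lam0; set a := e * lam; set b := _ * om; lra.
apply: (le_trans _ (mean_deep_mono _ _ thle)).
apply: le_trans (mean_deep_long_clock pX lam60 cX).
have h : expR (- (6 * lam / 16)) <= expR (- (eta ^+ 2 / 4 * (A * om))).
  rewrite ler_expR lerN2.
  apply: (@le_trans _ _ (1 / 16 * (A * om))).
    apply: ler_wpM2r => //.
    have : eta ^+ 2 <= 2^-1 ^+ 2 by apply: lerXn2r; rewrite ?nnegrE ?invr_ge0// ltW.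
    by rewrite !expr2; lra.
  have := expR_ge_linear (ltW ompos) om3; rewrite -lamE.
  by set u := A * om in Aom0 *; lra.
have := expR_ge0 (23 + (26 / 10 - A) * om).
have := expR_ge0 (- (eta ^+ 2 / 4 * (A * om))).
move: h; set a := expR _; set b := expR _; set c := expR _; lra.
Qed.

(** * Expected height *)

Let plain (x : seq bool) : seq (bool * (unit -> unit)) := [seq (b, id) | b <- x].
Let st0 : @labelled unit := (tree0, fun=> tt).

Lemma Ex_law_plain x (f : tree -> R) :
  Ex (law R x) f = mean (plain x) st0 (fun st => f st.1).
Proof. by rewrite -(Ex_law_mean _ (fun=> tt)) -map_comp map_id. Qed.

Lemma Ex_law_le x (f g : tree -> R) : (forall T, f T <= g T) ->
  Ex (law R x) f <= Ex (law R x) g.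
Proof. by move=> fg; rewrite !Ex_law_plain; exact: mean_le. Qed.

Lemma Pr_law_le1 n x (E : pred tree) : XX n x -> Pr (law R x) E <= 1.
Proof.
move=> Xx; rewrite -(law_mass1 R (XX_gt0 Xx)) Pr_Ex; apply: Ex_law_le => T.
by rewrite lern1 leq_b1.
Qed.

Lemma Pr_law_le x (E F : pred tree) : (forall T, E T -> F T) ->
  Pr (law R x) E <= Pr (law R x) F.
Proof.
move=> EF; rewrite !Pr_Ex; apply: Ex_law_le => T; rewrite ler_nat.
by case H: (E T) => //=; rewrite EF.
Qed.

Lemma Ex_height_ge x (a b : R) : 0 <= a <= b ->
  a * Pr (law R x) (fun T => a <= (height T)%:R)
  + (b - a) * Pr (law R x) (fun T => b <= (height T)%:R)
  <= Ex (law R x) (fun T => (height T)%:R).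
Proof.
move=> /andP[a0 ab]; rewrite !Pr_Ex !Ex_law_plain -!meanZ -meanD.
apply: mean_le => st; set H := (height _)%:R.
have H0 : 0 <= H by exact: ler0n.
case: (leP b H) => bH; case: (leP a H) => aH /=; lra.
Qed.

Lemma expRN_small (c K eps : R) : 0 < c -> 0 <= K -> 0 < eps ->
  exists om1 : R, forall om, om1 <= om -> K * expR (- (c * om)) <= eps.
Proof.
move=> c0 K0 eps0; exists (K / (c * eps)) => om omge.
have p : 0 < c * eps by exact: mulr_gt0.
have : K <= om * (c * eps) by rewrite -ler_pdivrMr.
have om0 : 0 <= om by apply: le_trans omge; rewrite divr_ge0// ltW.
have co0 : 0 <= c * om by rewrite mulr_ge0// ltW.
move=> H; rewrite expRN ler_pdivrMr ?expR_gt0//.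
have := ler_wpM2l (ltW eps0) (expR_ge1Dx (c * om)).
by rewrite mulrDr; lra.
Qed.

(** The height is at least [e * lam - 492 / 100 * om] with probability [P1], which tends to
    [1] too slowly to be multiplied by [lam], and at least [e * lam - c2 * om] with probability [P2], which
    is so close to [1] that [lam * (1 - P2)] is bounded; between these two bounds, the
    complementary probability [1 - P1] is only multiplied by [om]. *)
Lemma expectation_arith (om lam c2 P1 P2 : R) :
  lam = expR om -> 1000 <= om -> c2 = (e - 1 + 2^-1) * 24 + 11 / 100 ->
  9 * expR (- (1 / 2 * om)) <= 1 -> 3 * expR 23 * expR (- (20 * om)) <= 1 ->
  1 - 1 / 5500 <= P1 ->
  1 - 3 * expR (- (2^-1 ^+ 2 / 4 * (24 * om))) - expR (23 + (26 / 10 - 24) * om) <= P2 ->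
  0 <= e * lam - c2 * om <= e * lam - 492 / 100 * om /\
  e * lam - 5 * om <= (e * lam - c2 * om) * P2
    + (e * lam - 492 / 100 * om - (e * lam - c2 * om)) * P1.
Proof.
move=> lamE om1000 c2E.
have om0 : 0 <= om by lra.
have e2 := @e_ge2 R; have e3 := @e_le275 R.
have c2_le : c2 <= 55 by rewrite c2E; lra.
have c2_ge : 5 <= c2 by rewrite c2E; lra.
have lam0 : 0 <= lam by rewrite lamE expR_ge0.
have lam_om : 100 * om <= lam.
  rewrite lamE; apply: le_trans (expR_ge1Dxn 1 om0); rewrite (_ : 2`! = 2%N)//.
  have : 1000 * om <= om ^+ 2 by rewrite expr2; exact: ler_wpM2r.
  by set u := om ^+ 2; lra.
have elam3 : e * lam <= 3 * lam by apply: ler_wpM2r => //; lra.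
have elam2 : 2 * lam <= e * lam by apply: ler_wpM2r.
have c2om : c2 * om <= 55 * om by apply: ler_wpM2r.
have c2om5 : 5 * om <= c2 * om by apply: ler_wpM2r.
have c2om0 : 0 <= c2 * om by lra.
set a := e * lam - c2 * om.
have a0 : 0 <= a by rewrite /a; lra.
have ab : a <= e * lam - 492 / 100 * om by rewrite /a; lra.
have ba : e * lam - 492 / 100 * om - a <= 51 * om by rewrite /a; lra.
have ae : a <= e * lam by rewrite /a; lra.
move=> H5 H6 HP1 HP2; split; first by rewrite a0.
have X1 : 3 * lam * (3 * expR (- (2^-1 ^+ 2 / 4 * (24 * om)))) <= 1.
  apply: le_trans H5; rewrite lamE.
  have -> : - (1 / 2 * om) = om + - (2^-1 ^+ 2 / 4 * (24 * om)) by field.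
  by rewrite [in leRHS]expRD; set u := expR om; set v := expR _; lra.
have X2 : 3 * lam * expR (23 + (26 / 10 - 24) * om) <= 1.
  apply: le_trans H6.
  have -> : 23 + (26 / 10 - 24) * om = 23 + (- om + - (204 / 10 * om)) by field.
  rewrite expRD [expR (- om + _)]expRD.
  have -> : 3 * lam * (expR 23 * (expR (- om) * expR (- (204 / 10 * om))))
     = 3 * expR 23 * (lam * expR (- om)) * expR (- (204 / 10 * om)) by ring.
  rewrite lamE -expRD subrr expR0 mulr1; apply: ler_wpM2l.
    by rewrite mulr_ge0 ?expR_ge0.
  by rewrite ler_expR; lra.
set X := 3 * expR _ in HP2 X1; set Y := expR _ in HP2 X2.
have X0 : 0 <= X by rewrite mulr_ge0 ?expR_ge0.
have Y0 : 0 <= Y by exact: expR_ge0.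
have aX : a * (X + Y) <= 2.
  apply: (@le_trans _ _ (3 * lam * (X + Y))); last by rewrite mulrDr lerD.
  by apply: ler_wpM2r; [exact: addr_ge0|exact: le_trans ae elam3].
have b1 : a * (1 - X - Y) <= a * P2 by exact: ler_wpM2l.
rewrite -addrA -opprD mulrBr mulr1 in b1.
rewrite -/a; set b := e * lam - 492 / 100 * om in ab ba *.
have ba0 : 0 <= b - a by rewrite subr_ge0.
have b3 := ler_wpM2l ba0 HP1; rewrite mulrBr mulr1 in b3.
have bE : e * lam - 5 * om + 8 / 100 * om = b by rewrite /b; lra.
by move: aX b1 b3 ba bE om1000; clear; lra.
Qed.

Lemma near_ln_ln (c : R) : \forall n \near \oo, c <= ln (ln n%:R).
Proof.
exists (Num.trunc (expR (expR c))).+1 => // n /= nge.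
have h : expR (expR c) <= n%:R.
  by apply: ltW; apply: lt_le_trans (truncnS_gt _) _; rewrite ler_nat.
have n0 : 0 < n%:R :> R by apply: lt_le_trans h; exact: expR_gt0.
have h2 : expR c <= ln n%:R by rewrite -[leLHS]expRK ler_ln ?posrE ?expR_gt0.
rewrite -[leLHS]expRK ler_ln ?posrE ?expR_gt0//.
by apply: lt_le_trans h2; exact: expR_gt0.
Qed.

End Assembly.

Theorem theorem2 (R : realType) :
  let h (n : nat) : R := expR 1 * ln n%:R - 5 * ln (ln n%:R) in
  ((fun n : nat =>
      inf [set Pr (law R x) (fun T => h n <= (height T)%:R) | x in XX n])
     @ \oo --> (1 : R))
  /\
  (\forall n \near \oo,
      h n <= inf [set Ex (law R x) (fun T => (height T)%:R) | x in XX n]).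
Proof.
move=> h.
have A27 : 27 / 10 <= 27 / 10 :> R by [].
have eta1 : 0 < (3 / 100 : R) <= 2^-1 by lra.
have A24 : 27 / 10 <= 24 :> R by lra.
have eta2 : 0 < (2^-1 : R) <= 2^-1 by lra.
(* [A = 27 / 10] keeps the loss below 5 but its failure probability, a small power of
   [1 / ln n], cannot pay for a height of order [ln n] in the expectation; [A = 24] can. *)
have [om1 [om1_gt0 H1]] := Pr_height A27 eta1.
have [om2 [om2_gt0 H2]] := Pr_height A24 eta2.
have e3 := @e_le275 R.
have likely (eps : R) : 0 < eps -> \forall n \near \oo,
    0 < ln (ln n%:R) :> R /\ forall x, XX n x ->
    1 - eps <= Pr (law R x) (fun T =>
      expR 1 * ln n%:R - 492 / 100 * ln (ln n%:R) <= (height T)%:R :> R).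
  move=> eps0; have eps20 : 0 < eps / 2 by lra.
  have c10 : 0 < (3 / 100) ^+ 2 / 4 * (27 / 10) :> R by rewrite expr2; lra.
  have K1 : 0 <= 3 :> R by [].
  have [om3 H3] := expRN_small c10 K1 eps20.
  have c20 : 0 < 1 / 10 :> R by lra.
  have [om4 H4] := expRN_small c20 (expR_ge0 23) eps20.
  near=> n.
  have o1 : om1 <= ln (ln n%:R) by near: n; exact: near_ln_ln.
  have o3 : om3 <= ln (ln n%:R) by near: n; exact: near_ln_ln.
  have o4 : om4 <= ln (ln n%:R) by near: n; exact: near_ln_ln.
  have o0 : 0 < ln (ln n%:R) :> R by exact: lt_le_trans o1.
  split => // x Xx; have {H1} := H1 n x o1 Xx.
  move: {H3} (H3 _ o3) {H4} (H4 _ o4) o0; set om := ln (ln n%:R) => H3 H4 o0 H1.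
  apply: (le_trans (le_trans _ H1) (Pr_law_le _ _)) => [|T].
    move: H3 H4; rewrite -expRD.
    have -> : 23 + - (1 / 10 * om) = 23 + (26 / 10 - 27 / 10) * om by field.
    have -> : (3 / 100) ^+ 2 / 4 * (27 / 10) * om = (3 / 100) ^+ 2 / 4 * (27 / 10 * om).
      exact: esym (mulrA _ _ _).
    by set a := 3 * expR _; set b := expR _; lra.
  move=> /= hT; apply: (le_trans _ hT); rewrite -/om lerD2l lerN2.
  by apply: ler_wpM2r; [exact: ltW|move: e3; clear; lra].
split.
  apply/cvgrPdist_le => eps eps0; near=> n.
  have : 0 < ln (ln n%:R) :> R /\ forall x, XX n x ->
    1 - eps <= Pr (law R x) (fun T =>
      expR 1 * ln n%:R - 492 / 100 * ln (ln n%:R) <= (height T)%:R :> R).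
    by near: n; exact: likely.
  move=> [om0 Hn].
  have [[x Xx <-] _] := inf_XX_min n (fun x => Pr (law R x) (fun T => h n <= (height T)%:R)).
  have le1 := @Pr_law_le1 R n x (fun T => h n <= (height T)%:R) Xx.
  rewrite ger0_norm ?subr_ge0// lerBlDr -lerBlDl.
  apply: le_trans (Hn x Xx) _; apply: Pr_law_le => T /= hT; apply: (le_trans _ hT).
  by rewrite lerD2l lerN2; apply: ler_wpM2r; [exact: ltW|lra].
have c30 : 0 < 1 / 2 :> R by lra.
have K3 : 0 <= 9 :> R by [].
have [om5 H5] := expRN_small c30 K3 ltr01.
have c40 : 0 < 20 :> R by [].
have K4 : 0 <= 3 * expR 23 :> R by rewrite mulr_ge0// expR_ge0.
have [om6 H6] := expRN_small c40 K4 ltr01.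
have eps0 : 0 < 1 / 5500 :> R by lra.
near=> n.
have : 0 < ln (ln n%:R) :> R /\ forall x, XX n x ->
    1 - 1 / 5500 <= Pr (law R x) (fun T =>
      expR 1 * ln n%:R - 492 / 100 * ln (ln n%:R) <= (height T)%:R :> R).
  by near: n; exact: likely.
move=> [om0 Hn].
have o2 : om2 <= ln (ln n%:R) by near: n; exact: near_ln_ln.
have o5 : om5 <= ln (ln n%:R) by near: n; exact: near_ln_ln.
have o6 : om6 <= ln (ln n%:R) by near: n; exact: near_ln_ln.
have o7 : 1000 <= ln (ln n%:R) :> R by near: n; exact: near_ln_ln.
have [[x Xx <-] _] := inf_XX_min n (fun x => Ex (law R x) (fun T => (height T)%:R)).
have [n0 lam0 lamE] := natr_eq_expR_expR om0.
have P1 := Hn x Xx; have P2 := H2 n x o2 Xx.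
move: {H5} (H5 _ o5) {H6} (H6 _ o6) => H5 H6.
rewrite /h; set om := ln (ln n%:R) in om0 lamE P1 P2 H5 H6 o7 *.
set lam := ln n%:R in lam0 lamE P1 P2 *.
have [ab goal] := expectation_arith lamE o7 erefl H5 H6 P1 P2.
exact: le_trans goal (Ex_height_ge x ab).
Unshelve. all: end_near.
Qed.
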